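(* Let $d,N\ge1$ be integers and $u\in(0,1)$. Put $D=d+\log((1-u)^{-1})+2$, \[ H=\max\left\{12,\ \left\lceil\frac12\log_2\frac ND\right\rceil+2\right\},\qquad k_0=\min\left\{N,\ 2\left\lceil (d+1)(1+H\log2)+\log((1-u)^{-1})\right\rceil\right\}. \] Then for every prime power $q\ge N$, the finite-field polynomial construction over $\mathbb F_q$ with independence order $k=k_0$ (for any choice of the distinct elements $\xi_1,\ldots,\xi_N\in\mathbb F_q$ and of the bijection $\iota$) generates an $N$-point multiset $(\boldsymbol{X}_1,\ldots,\boldsymbol{X}_N)$ satisfying \[ D_N^*(\boldsymbol{X}_1,\ldots,\boldsymbol{X}_N)\le\frac92\sqrt{\frac{d+\log((1-u)^{-1})+2}{N}} \] with probability at least $u$.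
   Context: $\log$ denotes the natural logarithm and $\log_2$ the base-2 logarithm. For an $N$-point multiset $P=(\boldsymbol{x}_1,\ldots,\boldsymbol{x}_N)$ in $[0,1)^d$, the star discrepancy is \[ D_N^*(P)=\sup_{\boldsymbol{z}\in[0,1]^d}\left|\frac1N\sum_{n=1}^N\mathbf 1_{[\boldsymbol{0},\boldsymbol{z})}(\boldsymbol{x}_n)-\prod_{j=1}^d z_j\right|,\qquad [\boldsymbol{0},\boldsymbol{z})=\prod_{j=1}^d[0,z_j). \] Finite-field polynomial construction with independence order $k$. Let $d,N\ge1$ and $1\le k\le N$. Let $q\ge N$ be a prime power, let $\mathbb F_q$ be the field with $q$ elements, choose distinct elements $\xi_1,\ldots,\xi_N\in\mathbb F_q$, and fix a bijection $\iota:\mathbb F_q\to\{0,\ldots,q-1\}$. Choose $\boldsymbol{A}_0,\ldots,\boldsymbol{A}_{k-1}$ independently and uniformly from $\mathbb F_q^d$, and form the random vector-valued polynomial \[ \boldsymbol{F}(T)=\boldsymbol{A}_0+\boldsymbol{A}_1T+\cdots+\boldsymbol{A}_{k-1}T^{k-1}. \] For $1\le n\le N$, set $\boldsymbol{Y}_n=(Y_{n,1},\ldots,Y_{n,d})=\boldsymbol{F}(\xi_n)\in\mathbb F_q^d$ and define the grid point \[ \boldsymbol{X}_n=(X_{n,1},\ldots,X_{n,d}),\qquad X_{n,j}=\frac{\iota(Y_{n,j})}{q},\quad 1\le j\le d . \] The resulting ordered random family $(\boldsymbol{X}_1,\ldots,\boldsymbol{X}_N)$ is the finite-field polynomial construction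 with independence order $k$. *)

(* Defs.v *)
From HB Require Import structures.
From mathcomp Require Import all_boot all_order all_algebra.
From mathcomp Require Import all_classical all_reals all_analysis.

Set Implicit Arguments.
Unset Strict Implicit.
Unset Printing Implicit Defensive.

Import Order.TTheory GRing.Theory Num.Theory.

Local Open Scope classical_set_scope.
Local Open Scope ring_scope.

Section StarDiscrepancy.
Variables (R : realType) (d N : nat).

Definition anchored_box (z : 'rV[R]_d) : set 'rV[R]_d :=
  [set x : 'rV[R]_d | forall j, 0 <= x 0 j < z 0 j].

Definition local_discrepancy (x : 'I_N -> 'rV[R]_d) (z : 'rV[R]_d) : R :=
  N%:R^-1 * (\sum_(n < N) \1_(anchored_box z) (x n)) - \prod_(j < d) z 0 j.

(* An N-point multiset is an N-indexed family. For N > 0 the set below is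
   nonempty and bounded by 1, so [sup] is its actual supremum. *)
Definition star_discrepancy (x : 'I_N -> 'rV[R]_d) : R :=
  sup [set `|local_discrepancy x z| | z in
         [set z : 'rV[R]_d | forall j, 0 <= z 0 j <= 1]].

End StarDiscrepancy.

Section RandomElements.
Variables (R : realType) (disp : measure_display) (Omega : measurableType disp).
Variables (P : probability Omega R) (E : finType).

(* Random elements of the finite set E equipped with its discrete sigma-algebra. *)
Definition random_element (X : Omega -> E) : Prop :=
  forall B : set E, measurable (X @^-1` B).

Definition uniformly_distributed (X : Omega -> E) : Prop :=
  forall a : E, P (X @^-1` [set a]) = (#|E|%:R^-1)%:E.

Definition mutually_independent (k : nat) (X : 'I_k -> Omega -> E) : Prop :=
  forall (J : {set 'I_k}) (B : 'I_k -> set E),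
    P [set w | forall i, i \in J -> B i (X i w)]
    = (\prod_(i in J) P (X i @^-1` B i))%E.

Definition independent_uniform (k : nat) (X : 'I_k -> Omega -> E) : Prop :=
  [/\ forall i, random_element (X i),
      forall i, uniformly_distributed (X i)
    & mutually_independent X].

End RandomElements.

Section Construction.
Variables (F : finFieldType) (d k : nat).

Definition vector_poly_eval (A : 'I_k -> 'rV[F]_d) (t : F) : 'rV[F]_d :=
  \sum_(i < k) t ^+ i *: A i.

Definition polynomial_points (R : realType) (N : nat) (xi : 'I_N -> F)
    (iot : F -> 'I_#|F|) (A : 'I_k -> 'rV[F]_d) (n : 'I_N) : 'rV[R]_d :=
  \row_(j < d) ((iot (vector_poly_eval A (xi n) 0 j))%:R / #|F|%:R).

End Construction.

Section OrderBound.
Variables (R : realType) (d N : nat) (u : R).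

Definition log2 (x : R) : R := ln x / ln 2.

Definition paramD : R := d%:R + ln ((1 - u)^-1) + 2.

(* The inner ceiling may be negative, hence the type [int]. *)
Definition paramH : int :=
  Num.max 12%:Z (Num.ceil (2^-1 * log2 (N%:R / paramD)) + 2).

(* For 0 < u < 1 the ceiling is positive, so [absz] is a mere coercion to nat. *)
Definition param_k0 : nat :=
  minn N
    (2 * `|Num.ceil (d.+1%:R * (1 + paramH%:~R * ln 2) + ln ((1 - u)^-1))|)%N.

End OrderBound.

(* Main.v *)
Require Import Defs.
From HB Require Import structures.
From mathcomp Require Import all_boot all_order all_algebra.
From mathcomp Require Import all_classical all_reals all_analysis.
From mathcomp Require Import ring lra zify.
Set Implicit Arguments.
Unset Strict Implicit.
Unset Printing Implicit Defensive.
Import Order.TTheory GRing.Theory Num.Theory numFieldNormedType.Exports.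
Local Open Scope ring_scope.

(** The seed [A_0, ..., A_{k-1}] is uniform on a finite set, so the probability
    in the theorem is a proportion of seeds. By interpolation, the values of a
    polynomial of degree less than [k] at any [k] nodes determine it, so any [k]
    of the [N] points, viewed in [F ^ d], are independent and uniform
    ([polynomial_orthogonal_array]). A monomial of degree [2 m] in the points
    involves at most [min(N, 2 m)] of them; hence, as soon as
    [min(N, 2 m) <= k], the moment of order [2 m] of a sum over the points is
    the one of [N] independent points ([power_sum_average]). Bounding
    [y ^ (2 m)] by exponentials gives a sub-Gaussian tail ([tail_bound]): for a
    set of variance at most [sig2], with [m <= N sig2], the number of points in
    it is off by [t >= sqrt(6 m N sig2)] for a proportion at most [2 / 4 ^ m]
    of the seeds.

    These tails are summed over a multiscale family of boxes. At level [h] the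
    corners have coordinates [exp(- a_j / (d 2 ^ h))] with [a_j] natural
    numbers of bounded sum; there are at most
    [(e (2 ^ h (h - 1) + 1)) ^ d <= 4 ^ (d (1 + h ln 2))] of them
    ([card_bounded_sum], [polynomial_growth]). Rounding [a_j / 2] up maps level
    [h + 1] to level [h] and shrinks a box by at most [2 ^ -(h + 1)] in volume
    ([density_cell_half]), so that a box of the last level is the disjoint
    union of a box of the first level and of differences of rapidly decreasing
    variance ([deviation_chain]). With
    [m_h = ceil((d + 1) (1 + h ln 2) + ln (1 / (1 - u)))] the tail [2 / 4 ^ m_h]
    absorbs the size of level [h] and leaves [(1 - u) / 2 ^ h]
    ([union_bound_level]); the order [k0] is at least [min(N, 2 m_h)] for every
    [h <= H].

    An arbitrary box lies between two boxes of the last level [K]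
    ([local_discrepancy_le]); this costs [2 ^ -K], and replacing the volume of a
    box by its proportion of grid points costs [d / q <= d / N]. With
    [D = d + ln (1 / (1 - u)) + 2] and [s = sqrt(D / N)], so that
    [d / q <= s ^ 2], there are three regimes. If [s >= 2 / 9] the bound
    [9 / 2 * s] is at least [1]. If [1 / 16 <= s < 2 / 9], level 5 alone
    suffices: [3.76 s + 2 ^ -5 + s ^ 2 <= 4.5 s]. If [s < 1 / 16], the chain
    runs from level 12 to level [H], where [2 ^ -H <= s / 4], and
    [(3.76 + 0.4) s + s / 4 + s ^ 2 <= 4.5 s]. *)

(** * Numerical bounds on exponentials *)

Lemma compound_le_expR (R : realType) (n : nat) (x : R) :
  - n.+1%:R <= x -> (1 + x / n.+1%:R) ^+ n.+1 <= expR x.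
Proof.
move=> x_ge; have n_gt0 : 0 < n.+1%:R :> R by rewrite ltr0n.
rewrite -{2}(divfK (lt0r_neq0 n_gt0) x) expRM_natr; apply: lerXn2r.
- by rewrite nnegrE -lerBlDl sub0r ler_pdivlMr // mulN1r.
- by rewrite nnegrE expR_ge0.
- exact: expR_ge1Dx.
Qed.

Lemma expR1_bounds (R : realType) : 8 / 3 <= expR (1 : R) <= 3.
Proof.
apply/andP; split.
  by apply: le_trans (@compound_le_expR R 63 1 _); lra.
have : 3^-1 <= expR (- 1 : R).
  by apply: le_trans (@compound_le_expR R 7 (- 1) _); lra.
by rewrite expRN lef_pV2 ?posrE ?expR_gt0 ?ltr0n.
Qed.

Lemma ln2_bounds (R : realType) : 17 / 25 <= ln (2 : R) <= 7 / 10.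
Proof.
apply/andP; split; rewrite -ler_expR lnK ?posrE //.
  have : 2^-1 <= expR (- (17 / 25) : R).
    by apply: le_trans (@compound_le_expR R 31 (- (17 / 25)) _); lra.
  by rewrite expRN lef_pV2 ?posrE ?expR_gt0 ?ltr0n.
by apply: le_trans (@compound_le_expR R 63 (7 / 10) _); lra.
Qed.

(** This is [4 ^ (ln 2)], the factor by which [4 ^ (1 + h ln 2)] grows with [h]. *)
Lemma expR_ln4_ln2 (R : realType) : 5 / 2 <= expR (2 * ln 2 * ln 2) :> R.
Proof.
apply: (@le_trans _ _ (expR (2 * (17 / 25) * (17 / 25)))).
  by apply: le_trans (@compound_le_expR R 63 (2 * (17 / 25) * (17 / 25)) _); lra.
by have /andP[ln2_ge _] := ln2_bounds R; rewrite ler_expR; nra.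
Qed.

(** * Uniform averages and orthogonal arrays *)

(** The average of the indicator of an event is its probability under the
    uniform distribution; all probabilistic steps are phrased this way. *)
Definition average (R : realType) (T : finType) (g : T -> R) : R :=
  (\sum_t g t) / #|T|%:R.

Lemma eq_average (R : realType) (T : finType) (g g' : T -> R) :
  g =1 g' -> average g = average g'.
Proof. by move=> gg'; congr (_ / _); apply: eq_bigr => t _. Qed.

Lemma average_sum (R : realType) (T I : finType) (g : I -> T -> R) :
  average (fun t => \sum_i g i t) = \sum_i average (g i).
Proof. by rewrite /average exchange_big /= mulr_suml. Qed.

Lemma averageD (R : realType) (T : finType) (g g' : T -> R) :
  average (fun t => g t + g' t) = average g + average g'.
Proof. by rewrite /average big_split mulrDl. Qed.

Lemma averageZ (R : realType) (T : finType) (c : R) (g : T -> R) :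
  average (fun t => c * g t) = c * average g.
Proof. by rewrite /average mulrA mulr_sumr. Qed.

Lemma average_cst (R : realType) (T : finType) (c : R) :
  (0 < #|T|)%N -> average (fun _ : T => c) = c.
Proof.
move=> T_gt0; rewrite /average sumr_const -[c *+ _]mulr_natr mulfK //.
by rewrite pnatr_eq0 -lt0n.
Qed.

Lemma le_average (R : realType) (T : finType) (g g' : T -> R) :
  (forall t, g t <= g' t) -> average g <= average g'.
Proof.
by move=> gg'; rewrite ler_wpM2r ?invr_ge0 ?ler0n //; apply: ler_sum => t _.
Qed.

Lemma average_bij (R : realType) (T T' : finType) (h : T -> T') (g : T' -> R) :
  bijective h -> average (fun t => g (h t)) = average g.
Proof.
by move=> hbij; rewrite /average (bij_eq_card hbij) [in RHS](reindex h) //=; exact: onW_bij.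
Qed.

Lemma average_prod (R : realType) (I E : finType) (g : I -> E -> R) :
  average (fun x : {ffun I -> E} => \prod_i g i (x i)) = \prod_i average (g i).
Proof.
rewrite /average -bigA_distr_bigA card_ffun natrX.
by rewrite big_split /= prodr_const exprVn.
Qed.

(** A monomial of degree [r] in [N] variables involves at most [min(N, r)] of
    them, so [k] distinct variables suffice to express it. *)
Lemma covering_injection (N k r : nat) (phi : 'I_r -> 'I_N) :
  (minn N r <= k <= N)%N ->
  exists (sigma : 'I_k -> 'I_N) (psi : 'I_r -> 'I_k),
    injective sigma /\ forall i, phi i = sigma (psi i).
Proof.
move=> /andP[rk kN].
pose S := [set phi i | i : 'I_r]%SET.
pose s := enum S ++ enum (~: S)%SET.
have size_s : size s = N by rewrite size_cat -!cardE cardsC card_ord.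
have uniq_s : uniq s.
  rewrite cat_uniq !enum_uniq /= andbT; apply/hasPn => x.
  by rewrite !mem_enum inE.
have S_le : (#|S| <= k)%N.
  apply: leq_trans rk; rewrite leq_min; apply/andP; split.
    by apply: leq_trans (max_card _) _; rewrite card_ord.
  by apply: leq_trans (leq_imset_card _ _) _; rewrite card_ord.
have lts (i : 'I_k) : (i < size s)%N by rewrite size_s (leq_trans (ltn_ord i)).
have idx (i : 'I_r) : (index (phi i) s < k)%N.
  have phiS : phi i \in enum S by rewrite mem_enum; apply: imset_f.
  rewrite index_cat phiS; apply: leq_trans S_le.
  by rewrite cardE index_mem.
exists (fun i : 'I_k => tnth (in_tuple s) (Ordinal (lts i))), (fun i => Ordinal (idx i)).
split=> [i j|i].
  have x0 : 'I_N := tnth (in_tuple s) (Ordinal (lts i)).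
  rewrite !(tnth_nth x0) /= => /eqP.
  by rewrite nth_uniq // => /eqP /ord_inj.
rewrite (tnth_nth (phi i)) /= nth_index // mem_cat !mem_enum inE.
by case: (phi i \in S).
Qed.

(** Asking for a bijection, and not only for a uniform distribution, of the
    entries at any [k] positions is what the interpolation of polynomials
    provides: there are as many seeds as [k]-tuples of values. *)
Definition index_one_orthogonal_array (E T : finType) (k N : nat)
    (X : T -> 'I_N -> E) : Prop :=
  forall sigma : 'I_k -> 'I_N, injective sigma ->
    bijective (fun t => [ffun i => X t (sigma i)]).

Lemma prod_comp_fibers (R : realType) (E : finType) (f : E -> R) (r : nat) (I : finType)
    (psi : 'I_r -> I) (x : I -> E) :
  \prod_i f (x (psi i)) = \prod_l f (x l) ^+ #|[pred i | psi i == l]|.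
Proof.
rewrite (partition_big psi xpredT) //=; apply: eq_bigr => l _.
by rewrite -prodr_const; apply: eq_bigr => i /eqP ->.
Qed.

(** The power expands into monomials of degree [r]; each of them lives on [k]
    positions, where both families are uniform on [E ^ k]. The case
    [k = N], in which [r] is unrestricted, is included. *)
Lemma power_sum_average (R : realType) (E T : finType) (k N r : nat)
    (X : T -> 'I_N -> E) (f : E -> R) :
  (minn N r <= k <= N)%N -> (0 < #|E|)%N -> index_one_orthogonal_array k X ->
  average (fun t => (\sum_n f (X t n)) ^+ r)
  = average (fun x : {ffun 'I_N -> E} => (\sum_n f (x n)) ^+ r).
Proof.
move=> rkN E_gt0 Xoa.
have expand (y : 'I_N -> E) : (\sum_n f (y n)) ^+ r
    = \sum_(phi : {ffun 'I_r -> 'I_N}) \prod_i f (y (phi i)).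
  by rewrite -(bigA_distr_bigA (fun _ n => f (y n))) prodr_const card_ord.
under eq_average do rewrite expand.
under [RHS]eq_average do rewrite expand.
rewrite !average_sum; apply: eq_bigr => phi _.
have [sigma [psi [sigma_inj phiE]]] := covering_injection phi rkN.
transitivity (average (fun y : {ffun 'I_k -> E} => \prod_i f (y (psi i)))).
  rewrite -(average_bij _ (Xoa _ sigma_inj)); apply: eq_average => t.
  by apply: eq_bigr => i _; rewrite ffunE phiE.
under eq_average do rewrite prod_comp_fibers.
under [RHS]eq_average do rewrite prod_comp_fibers.
rewrite !(average_prod (fun l e => f e ^+ _)).
(* Positions outside the range of sigma carry the exponent 0. *)
pose J := [set sigma l | l in 'I_k]%SET.
rewrite [RHS](bigID (mem J)) /= [X in _ * X]big1 ?mulr1; last first.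
  move=> n nsigma; rewrite (_ : #|_| = 0%N) ?average_cst //.
  apply: eq_card0 => i; rewrite !inE phiE; apply/negP => /eqP sn.
  by move: nsigma; rewrite -sn imset_f.
rewrite big_imset /=; last by move=> i j _ _; exact: sigma_inj.
apply: eq_bigr => l _; apply: eq_average => e; congr (_ ^+ _).
by apply: eq_card => i; rewrite !inE phiE (inj_eq sigma_inj).
Qed.

(** * Moments and tails *)

(** The function [exp(- y) (1 + y + y ^ 2)] has derivative
    [exp(- y) y (1 - y)], so on [y <= 1] it attains its minimum [1] at [0]. *)
Lemma expR_le_quadratic (R : realType) (x : R) :
  x <= 1 -> expR x <= 1 + x + x ^+ 2.
Proof.
move=> x_le1; pose g (y : R) : R := expR (- y) * (1 + y + y ^+ 2).
have gD (y : R) : is_derive y (1 : R) g (expR (- y) * (y * (1 - y))).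
  by rewrite /g; apply: is_derive_eq; rewrite !scaler1 /GRing.scale /= ; ring.
have gder y : derivable g y 1 by case: (gD y).
have gcont (A : set R) : ({within A, continuous g})%classic.
  apply: continuous_subspaceT.
  have gc : continuous g.
    by move=> y; apply: differentiable_continuous; apply/derivable1_diffP.
  exact: gc.
have g0 : g 0 = 1 by rewrite /g oppr0 expR0; ring.
suff : 1 <= g x.
  rewrite /g expRN mulrC ler_pdivlMr ?expR_gt0 //; by rewrite mul1r.
have [x_ge0|x_lt0] := leP 0 x.
  rewrite -g0; apply: (@ger0_derive1_le_cc R g 0 1) => //.
  - move=> y; rewrite in_itv /= => /andP[y0 y1].
    rewrite derive1E (@derive_val _ _ _ _ _ _ _ (gD y)).
    by rewrite mulr_ge0 ?expR_ge0 // mulr_ge0 ?subr_ge0 ?ltW.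
  - by rewrite in_itv /= lexx ler01.
  - by rewrite in_itv /= x_ge0.
rewrite -g0; apply: (@ler0_derive1_le_cc R g x 0) => //.
- move=> y; rewrite in_itv /= => /andP[y0 y1].
  rewrite derive1E (@derive_val _ _ _ _ _ _ _ (gD y)).
  by rewrite mulr_ge0_le0 ?expR_ge0 // nmulr_rle0 // subr_ge0; lra.
- by rewrite in_itv /= lexx ltW.
- by rewrite in_itv /= lexx ltW.
- exact: ltW.
Qed.

(** This is [t <= exp(t - 1)] at [t = x / n], raised to the power [n]. *)
Lemma exprn_le_expR (R : realType) (n : nat) (x : R) :
  0 <= x -> x ^+ n <= n%:R ^+ n * expR (x - n%:R).
Proof.
move=> x_ge0; case: n => [|n]; first by rewrite !expr0 mul1r subr0 -expR0 ler_expR.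
have n_gt0 : 0 < n.+1%:R :> R by rewrite ltr0n.
have -> : x - n.+1%:R = (x / n.+1%:R - 1) * n.+1%:R.
  by rewrite mulrBl divfK ?mul1r ?gt_eqF.
rewrite expRM_natr -exprMn; apply: lerXn2r => //.
  by rewrite nnegrE mulr_ge0 ?expR_ge0 // ltW.
rewrite mulrC -ler_pdivrMr //; apply: le_trans (expR_ge1Dx _).
by rewrite addrC subrK.
Qed.

Lemma even_power_le_expR (R : realType) (m : nat) (y : R) :
  y ^+ (2 * m) <= (2 * m)%:R ^+ (2 * m) * expR (- (2 * m)%:R) * (expR y + expR (- y)).
Proof.
have -> : y ^+ (2 * m) = `|y| ^+ (2 * m) by rewrite !exprM real_normK ?num_real.
apply: le_trans (exprn_le_expR _ (normr_ge0 y)) _.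
rewrite -mulrA ler_wpM2l ?exprn_ge0 ?ler0n // addrC expRD.
rewrite ler_wpM2l ?expR_ge0 //; case: (ler0P y) => _.
  by rewrite lerDr expR_ge0.
by rewrite lerDl expR_ge0.
Qed.

(** Independence turns the average into a power, and
    [exp(lam f) <= 1 + lam f + lam ^ 2 f ^ 2] has average at most
    [1 + lam ^ 2 sig2]. *)
Lemma mgf_bound (R : realType) (E : finType) (N : nat) (f : E -> R) (lam sig2 : R) :
  (0 < #|E|)%N -> (forall e, `|f e| <= 1) -> average f = 0 ->
  average (fun e => f e ^+ 2) <= sig2 -> `|lam| <= 1 ->
  average (fun x : {ffun 'I_N -> E} => expR (lam * \sum_n f (x n)))
    <= expR (N%:R * (lam ^+ 2 * sig2)).
Proof.
move=> E_gt0 f_le1 f0 f2 lam1.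
under eq_average do rewrite mulr_sumr expR_sum.
rewrite (average_prod (fun _ e => expR (lam * f e))) prodr_const card_ord mulrC expRM_natr.
apply: lerXn2r; rewrite ?nnegrE ?expR_ge0 //.
  by rewrite divr_ge0 ?ler0n ?sumr_ge0 // => e _; rewrite expR_ge0.
apply: le_trans (expR_ge1Dx _).
apply: (@le_trans _ _ (average (fun e => 1 + lam * f e + lam ^+ 2 * f e ^+ 2))).
  apply: le_average => e; rewrite -exprMn; apply: expR_le_quadratic.
  apply: le_trans (ler_norm _) _; rewrite normrM.
  by rewrite mulr_ile1 ?normr_ge0.
rewrite !averageD !averageZ f0 mulr0 addr0 average_cst // lerD2l.
by rewrite ler_wpM2l ?sqr_ge0.
Qed.

(** Markov's inequality for the moment of order [2 m], which may be computed for
    independent points and is then at most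
    [(2 m / (e lam)) ^ (2 m)] times [2 exp(N lam ^ 2 sig2)]. The choice
    [lam ^ 2 = m / (N sig2)] yields [2 (4 m N sig2 / (e t ^ 2)) ^ m], and
    [16 / e <= 6]. The condition [m <= N sig2] says [lam <= 1]. *)
Lemma tail_bound (R : realType) (E T : finType) (k N m : nat) (X : T -> 'I_N -> E)
    (f : E -> R) (sig2 t : R) :
  (minn N (2 * m) <= k <= N)%N -> (0 < #|E|)%N -> index_one_orthogonal_array k X ->
  (forall e, `|f e| <= 1) -> average f = 0 -> average (fun e => f e ^+ 2) <= sig2 ->
  (0 < m)%N -> m%:R <= N%:R * sig2 -> 0 <= t -> 6 * m%:R * (N%:R * sig2) <= t ^+ 2 ->
  average (fun s => (t <= `|\sum_n f (X s n)|)%R%:R : R) <= 2 * 4^-1 ^+ m.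
Proof.
move=> kN E_gt0 Xoa f_le1 f0 f2 m_gt0 m_le t_ge0 t2.
have mR_gt0 : 0 < m%:R :> R by rewrite ltr0n.
set v := N%:R * sig2 in m_le t2.
have v_gt0 : 0 < v by apply: lt_le_trans m_le.
have t2_gt0 : 0 < t ^+ 2 by apply: lt_le_trans t2; rewrite (mulr_gt0 _ v_gt0) // mulr_gt0.
have t_gt0 : 0 < t by rewrite lt_neqAle t_ge0 andbT eq_sym -sqrf_eq0 gt_eqF.
pose lam := Num.sqrt (m%:R / v).
have lam2 : lam ^+ 2 = m%:R / v by rewrite sqr_sqrtr // divr_ge0 ?ltW.
have lam_ge0 : 0 <= lam by exact: sqrtr_ge0.
have lam_le1 : `|lam| <= 1.
  rewrite ger0_norm // -(@expr_le1 _ 2) // lam2 ler_pdivrMr // mul1r //.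
have mv_gt0 : 0 < m%:R / v by rewrite divr_gt0.
(* Markov's inequality for the moment of order 2m *)
apply: (@le_trans _ _ (average (fun s => (t ^+ 2) ^- m * (\sum_n f (X s n)) ^+ (2 * m)))).
  apply: le_average => s.
  set S := \sum_n _; have S2 : 0 <= (t ^+ 2) ^- m * S ^+ (2 * m).
    by apply: mulr_ge0; [rewrite invr_ge0|rewrite exprM]; exact/exprn_ge0/sqr_ge0.
  case: (leP t) => [tS|_] //=.
  rewrite mulrC ler_pdivlMr ?exprn_gt0 // mul1r exprM.
  apply: lerXn2r; rewrite ?nnegrE ?sqr_ge0 // -(real_normK (num_real S)).
  by apply: lerXn2r; rewrite ?nnegrE.
rewrite averageZ (power_sum_average f kN E_gt0 Xoa).
(* The factor (m / v) ^ m below is lam ^ (2 m). *)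
have moment : average (fun x : {ffun 'I_N -> E} => (\sum_n f (x n)) ^+ (2 * m))
    <= 2 * (4 * m%:R * v / expR 1) ^+ m.
  rewrite -(ler_pM2l (exprn_gt0 m mv_gt0)) -averageZ.
  apply: (@le_trans _ _ (average (fun x : {ffun 'I_N -> E} =>
     (2 * m)%:R ^+ (2 * m) * expR (- (2 * m)%:R) *
      (expR (lam * \sum_n f (x n)) + expR (- lam * \sum_n f (x n)))))).
    apply: le_average => x; rewrite -lam2 -exprM -exprMn mulNr.
    exact: even_power_le_expR.
  rewrite averageZ averageD.
  apply: (@le_trans _ _ ((2 * m)%:R ^+ (2 * m) * expR (- (2 * m)%:R) *
      (expR m%:R + expR m%:R))).
    rewrite ler_wpM2l ?mulr_ge0 ?exprn_ge0 ?ler0n ?expR_ge0 //.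
    have vE : N%:R * (lam ^+ 2 * sig2) = m%:R.
      by rewrite mulrCA -/v lam2 divfK ?gt_eqF.
    apply: lerD; rewrite -vE; first exact: mgf_bound.
    by rewrite -[in leRHS]sqrrN; apply: mgf_bound; rewrite ?normrN.
  have -> : expR (- (2 * m)%:R : R) = (expR 1 ^- 2) ^+ m.
    by rewrite -exprVn -expRN -exprM -expRM_natr natrM mulN1r.
  have -> : expR (m%:R : R) = expR 1 ^+ m by rewrite -expRM_natr mul1r.
  have -> : (2 * m)%:R ^+ (2 * m) = ((2 * m%:R) ^+ 2) ^+ m :> R.
    by rewrite exprM natrM.
  have base : m%:R / v * (4 * m%:R * v / expR 1)
      = (2 * m%:R) ^+ 2 * expR 1 ^- 2 * expR 1 :> R.
    by field; rewrite !gt_eqF ?expR_gt0.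
  by rewrite [leRHS]mulrCA -!exprMn base -mulr2n -[_ ^+ m *+ 2]mulr_natl [leLHS]mulrCA -exprMn.
apply: le_trans (ler_wpM2l _ moment) _.
  by rewrite invr_ge0 exprn_ge0 ?sqr_ge0.
rewrite mulrCA ler_wpM2l // -exprVn -exprMn; apply: lerXn2r.
- rewrite nnegrE; apply: mulr_ge0; first by rewrite invr_ge0 sqr_ge0.
  apply: divr_ge0 (expR_ge0 _); apply: mulr_ge0; last exact: ltW.
  by rewrite mulr_ge0 // ler0n.
- by rewrite nnegrE.
rewrite mulrC ler_pdivrMr // ler_pdivrMr ?expR_gt0 //.
have /andP[e_ge _] := expR1_bounds R; set e := expR 1 in e_ge *.
apply: (@le_trans _ _ (4^-1 * (6 * m%:R * v) * e)); last first.
  by rewrite ler_wpM2r ?expR_ge0 // ler_wpM2l.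
have -> : 4^-1 * (6 * m%:R * v) * e = (3/2 * e) * (m%:R * v) by field.
have mv_ge0 : 0 <= m%:R * v by exact/ltW/mulr_gt0.
rewrite -mulrA; apply: ler_wpM2r => //; lra.
Qed.

(** * Polynomial points and grid boxes *)

(** Coordinatewise, a polynomial of degree less than [k] vanishing at [k]
    distinct nodes is zero, and an injective map between finite sets of the same
    size is bijective. *)
Lemma polynomial_orthogonal_array (F : finFieldType) (d k N : nat) (xi : 'I_N -> F) :
  injective xi ->
  index_one_orthogonal_array k
    (fun (A : {ffun 'I_k -> 'rV[F]_d}) n => vector_poly_eval A (xi n)).
Proof.
move=> xi_inj sigma sigma_inj; apply: injF_bij => A B /ffunP eqAB.
apply/ffunP => i; apply/rowP => j.
pose p := rVpoly (\row_(l < k) (A l 0 j - B l 0 j)).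
suff p0 : p = 0.
  have := coef_rVpoly_ord (\row_(l < k) (A l 0 j - B l 0 j)) i.
  by rewrite -/p p0 coef0 mxE => /esym/eqP; rewrite subr_eq0 => /eqP.
apply: (@roots_geq_poly_eq0 _ _ [seq xi (sigma l) | l : 'I_k]).
- apply/allP => _ /mapP[l _ ->]; apply/rootP.
  rewrite (horner_coef_wide _ (size_poly _ _)).
  have := congr1 (fun v : 'rV_d => v 0 j) (eqAB l).
  rewrite !ffunE /vector_poly_eval !summxE => /eqP; rewrite -subr_eq0 -sumrB => /eqP; apply: etrans.
  apply: eq_bigr => m _; rewrite coef_rVpoly_ord !mxE; ring.
- by rewrite map_inj_uniq ?enum_uniq // => l m /xi_inj /sigma_inj.
- by rewrite size_map -cardE card_ord size_poly.
Qed.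

Definition density (R : realType) (E : finType) (B : {set E}) : R :=
  average (fun e => (e \in B)%:R).

Lemma densityE (R : realType) (E : finType) (B : {set E}) :
  density R B = #|B|%:R / #|E|%:R.
Proof.
by rewrite /density /average -natr_sum -big_mkcond sum1_card.
Qed.

Lemma density_ge0 (R : realType) (E : finType) (B : {set E}) : 0 <= density R B.
Proof. by rewrite densityE divr_ge0. Qed.

Lemma density_le1 (R : realType) (E : finType) (B : {set E}) : density R B <= 1.
Proof.
rewrite densityE; case: (posnP #|E|) => [->|E_gt0]; first by rewrite invr0 mulr0 ler01.
by rewrite ler_pdivrMr ?ltr0n // mul1r ler_nat max_card.
Qed.

Lemma densityD (R : realType) (E : finType) (B C : {set E}) :
  C \subset B -> density R (B :\: C)%SET = density R B - density R C.
Proof.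
move=> CB; rewrite !densityE -mulrBl; congr (_ / _).
by rewrite cardsD (finset.setIidPr CB) natrB ?subset_leq_card.
Qed.

(** The cardinality is the ceiling of [y]. *)
Lemma card_ord_below (R : realType) (n : nat) (y : R) :
  0 <= y <= n%:R -> y <= #|[pred i : 'I_n | i%:R < y]|%:R <= y + 1.
Proof.
move=> /andP[y_ge0 y_le].
have /andP[c_lo c_hi] := ceil_itv y.
have c_ge0 : 0 <= Num.ceil y by rewrite ceil_ge0; lra.
case E : (Num.ceil y) c_lo c_hi c_ge0 => [c|//] c_lo c_hi _.
have lt_c (i : nat) : (i%:R < y) = (i < c)%N.
  by have := ceil_gt_int y i; rewrite E ltz_nat.
have c_le : (c <= n)%N.
  by rewrite leqNgt -lt_c -leNgt.
rewrite -sum1_card (eq_bigl (fun i : 'I_n => (i < c)%N)); last by move=> i; rewrite !inE.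
rewrite (big_ord_narrow c_le) sum1_card card_ord.
by apply/andP; split; [exact: c_hi|move: c_lo; rewrite intrD /=; lra].
Qed.

Lemma prod_perturb (R : realType) (d : nat) (z g : 'I_d -> R) (delta : R) :
  0 <= delta -> (forall j, 0 <= z j <= g j) -> (forall j, g j <= 1) ->
  (forall j, g j <= z j + delta) ->
  \prod_j g j <= \prod_j z j + d%:R * delta.
Proof.
move=> delta_ge0 zg g1 gz.
pose K (G Z s : R) := [/\ 0 <= Z, Z <= 1, 0 <= s & G <= Z + s].
suff [_ _ _] : K (\prod_j g j) (\prod_j z j) (\sum_(j < d) delta).
  by rewrite sumr_const card_ord -[_ *+ d]mulr_natl.
apply: (big_rec3 K) => [|j G Z s _ [Z0 Z1 s0 GZ]]; first by split; lra.
have /andP[z0 zg_j] := zg j; have g1_j := g1 j; have gz_j := gz j.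
have gG : g j * G <= g j * (Z + s) by apply: ler_wpM2l => //; lra.
have gs : g j * s <= s by apply: ler_piMl.
have gZ : g j * Z <= (z j + delta) * Z by apply: ler_wpM2r.
have dZ : delta * Z <= delta by apply: ler_piMr.
split; [exact: mulr_ge0|by nra|exact: addr_ge0|lra].
Qed.

Section GridBoxes.
Variables (R : realType) (F : finFieldType) (d : nat) (iot : F -> 'I_#|F|).
Hypothesis iot_bij : bijective iot.

Definition below (z : 'I_d -> R) : {set 'rV[F]_d} :=
  [set v : 'rV[F]_d | [forall j, (iot (v 0 j))%:R / #|F|%:R < z j]]%SET.

Definition below1 (y : R) : {set F} := [set x : F | (iot x)%:R / #|F|%:R < y]%SET.

Let q_gt0 : 0 < #|F|%:R :> R.
Proof. by rewrite ltr0n; apply/card_gt0P; exists 0. Qed.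

Lemma density_below1 (y : R) : 0 <= y <= 1 ->
  y <= density R (below1 y) <= y + #|F|%:R^-1.
Proof.
move=> /andP[y0 y1].
have := @card_ord_below R #|F| (y * #|F|%:R).
rewrite mulr_ge0 ?(ltW q_gt0) // ler_piMl ?(ltW q_gt0) //= => /(_ isT).
rewrite densityE (_ : #|below1 y| = #|[pred i : 'I_#|F| | i%:R < y * #|F|%:R]|).
  by rewrite ler_pdivlMr // ler_pdivrMr // mulrDl mulVf ?gt_eqF.
have [g gK Kg] := iot_bij.
rewrite -(card_imset _ (can_inj gK)); apply: eq_card => i.
rewrite !inE; apply/imsetP/idP => [[x]|iy].
  by rewrite inE ltr_pdivrMr // => ? ->.
by exists (g i); rewrite ?Kg // inE Kg ltr_pdivrMr.
Qed.

Lemma density_belowE (z : 'I_d -> R) :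
  density R (below z) = \prod_j density R (below1 (z j)).
Proof.
rewrite /density -(average_prod (fun j x => (x \in below1 (z j))%:R)).
rewrite -(@average_bij R _ _ (fun f : {ffun 'I_d -> F} => \row_j f j)); last first.
  exists (fun v : 'rV[F]_d => [ffun j => v 0 j]) => [f|v].
    by apply/ffunP => j; rewrite ffunE mxE.
  by apply/rowP => j; rewrite mxE ffunE.
apply: eq_average => f; rewrite inE.
under eq_forallb => j do rewrite mxE.
have [fz|] := boolP [forall j, (iot (f j))%:R / #|F|%:R < z j].
  rewrite big1 // => j _; rewrite inE; by move/forallP: fz => /(_ j) ->.
by case/forallPn => j nz; rewrite (bigD1 j) //= !inE (negbTE nz) mul0r.
Qed.

(** The grid points have coordinates in [{0, 1 / q, ..., (q - 1) / q}], so
    each side of the box is overestimated by at most [1 / q]. *)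
Lemma density_below (z : 'I_d -> R) : (forall j, 0 <= z j <= 1) ->
  \prod_j z j <= density R (below z) <= \prod_j z j + d%:R / #|F|%:R.
Proof.
move=> z01; rewrite density_belowE; apply/andP; split.
  apply: ler_prod => j _; have /andP[z0 _] := z01 j.
  by have /andP[-> _] := density_below1 (z01 j); rewrite z0.
apply: prod_perturb => [|j|j|j].
- by rewrite invr_ge0 ltW.
- by have /andP[-> _] := z01 j; have /andP[-> _] := density_below1 (z01 j).
- exact: density_le1.
- by have /andP[_ ->] := density_below1 (z01 j).
Qed.

Lemma subset_below (z z' : 'I_d -> R) : (forall j, z j <= z' j) ->
  below z \subset below z'.
Proof.
move=> zz'; apply/fintype.subsetP => v; rewrite !inE => /forallP vz.
by apply/forallP => j; apply: lt_le_trans (zz' j).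
Qed.

End GridBoxes.

(** * Size and truncation of the box families *)

(** Exponential weighting: the indicator of [sum f <= d K] is at most
    [exp((d K - sum f) / K)], which factors over the coordinates into
    geometric series of sum at most [K + 1]. *)
Lemma card_bounded_sum (R : realType) (d K : nat) : (0 < K)%N ->
  #|[set f : {ffun 'I_d -> 'I_(d * K).+1} | (\sum_j f j <= d * K)%N]|%:R
    <= (expR 1 * K.+1%:R) ^+ d :> R.
Proof.
move=> K_gt0; set M := (d * K)%N.
have KR : 0 < K%:R :> R by rewrite ltr0n.
pose r : R := expR (- K%:R^-1).
have r_le : r * K.+1%:R <= K%:R.
  rewrite /r expRN mulrC ler_pdivrMr ?expR_gt0 //.
  apply: (@le_trans _ _ (K%:R * (1 + K%:R^-1))).
    by rewrite mulrDr mulr1 divff ?gt_eqF // -natr1.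
  by rewrite ler_wpM2l ?ler0n ?expR_ge1Dx.
have geom n : \sum_(i < n) r ^+ i <= K.+1%:R.
  have r_lt1 : 0 < 1 - r.
    by rewrite subr_gt0 /r expR_lt1 oppr_lt0 invr_gt0.
  rewrite -(ler_pM2l r_lt1).
  have -> : (1 - r) * \sum_(i < n) r ^+ i = 1 - r ^+ n.
    by rewrite -[1 - r]opprB mulNr -subrX1 opprB.
  apply: (@le_trans _ _ 1); first by rewrite lerBlDr lerDl exprn_ge0 ?expR_ge0.
  by move: r_le; rewrite mulrBl mul1r -natr1; lra.
have rM (f : {ffun 'I_d -> 'I_M.+1}) :
    \prod_j (expR 1 * r ^+ f j) = expR ((M%:R - (\sum_j f j)%:R) / K%:R).
  rewrite big_split /= prodr_const card_ord -expr_sum /r -!expRM_natr mul1r -expRD.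
  congr expR; rewrite mulrBl /M natrM mulfK ?gt_eqF //.
  by rewrite mulNr mulrC.
rewrite -sum1_card natr_sum.
apply: (@le_trans _ _ (\sum_(f : {ffun 'I_d -> 'I_M.+1}) \prod_j (expR 1 * r ^+ f j))).
  rewrite big_mkcond; apply: ler_sum => f _; rewrite inE rM.
  case: leqP => [fM|_]; last exact: expR_ge0.
  by rewrite -[leLHS]expR0 ler_expR divr_ge0 // subr_ge0 ler_nat.
rewrite -(bigA_distr_bigA (fun _ (i : 'I_M.+1) => expR 1 * r ^+ i)) prodr_const card_ord.
apply: lerXn2r.
- by rewrite nnegrE sumr_ge0 // => i _; rewrite mulr_ge0 ?exprn_ge0 ?expR_ge0.
- by rewrite nnegrE mulr_ge0 ?expR_ge0.
by rewrite -mulr_sumr ler_wpM2l ?expR_ge0.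
Qed.

(** A discrete intermediate value property: a box that is too small to belong to
    its family is enlarged to one at the cutoff. *)
Lemma lower_sum (d M : nat) (b : 'I_d -> nat) : (M <= \sum_j b j)%N ->
  exists2 c : 'I_d -> nat, (forall j, c j <= b j)%N & (\sum_j c j)%N = M.
Proof.
move En : (\sum_j b j - M)%N => n; elim: n b En => [|n IHn] b En Mb.
  by exists b => //; lia.
have [j bj] : exists j, (0 < b j)%N.
  apply/existsP; apply: contraT => /existsPn b0.
  suff : (\sum_j b j)%N = 0%N by lia.
  by rewrite big1 // => j _; have := b0 j; lia.
pose b' i := if i == j then (b j).-1 else b i.
have b'b : (\sum_i b' i).+1 = (\sum_i b i)%N.
  rewrite (bigD1 j) // [RHS](bigD1 j) //= /b' eqxx -addSn prednK //; congr (_ + _)%N.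
  by apply: eq_bigr => i /negbTE ->.
have [||c cb' sc] := IHn b'; [lia|lia|].
exists c => // i; apply: leq_trans (cb' i) _; rewrite /b'.
by case: eqP => // ->; exact: leq_pred.
Qed.

Lemma expR_decay (R : realType) (x : R) (n : nat) :
  x <= 1 / 32 -> expR (x - n%:R) <= 32 / 31 * (3 / 8) ^+ n.
Proof.
move=> x_le; rewrite expRD; apply: ler_pM; rewrite ?expR_ge0 //.
  rewrite -[x]opprK expRN invf_ple ?posrE ?expR_gt0 ?divr_gt0 //.
  by apply: le_trans (expR_ge1Dx _); lra.
rewrite -[n%:R]mul1r -mulNr expRM_natr; apply: lerXn2r; rewrite ?nnegrE ?expR_ge0 //.
have /andP[e_ge _] := expR1_bounds R.
by rewrite expRN invf_ple ?posrE ?expR_gt0 ?divr_gt0 // invf_div.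
Qed.

Lemma geometric_decay (R : realType) (n : nat) : (3 / 8) ^+ n <= 2 ^- n :> R.
Proof. by rewrite -exprVn; apply: lerXn2r; rewrite ?nnegrE; lra. Qed.

(** The boxes at the cutoff of level [h] have volume [exp(- (h - 1))]; the term
    [x] accounts for the rounding of the corners. *)
Lemma cutoff_decay (R : realType) (x : R) (h : nat) :
  (5 <= h)%N -> x <= 1 / 32 -> expR (x - h.-1%:R) <= 2 ^- h.
Proof.
move=> /subnKC <-; move: (h - 5)%N => n x_le.
apply: le_trans (expR_decay _ x_le) _.
rewrite (_ : (5 + n).-1 = n + 4)%N; last by lia.
have := geometric_decay R n; rewrite addnC -!exprVn !exprD => n_le.
have : 0 <= 2^-1 ^+ n :> R by rewrite exprn_ge0 // invr_ge0.
by lra.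
Qed.

(** The rate [8 / 3] of the exponential beats [2] by enough, from level 12 on, to
    gain the additional factor [2] needed for differences of levels. *)
Lemma cutoff_decay_strong (R : realType) (x : R) (h : nat) :
  (12 <= h)%N -> x <= 1 / 32 -> expR (x - h.-1%:R) <= 2 ^- h.+1.
Proof.
move=> /subnKC <-; move: (h - 12)%N => n x_le.
apply: le_trans (expR_decay _ x_le) _.
rewrite (_ : (12 + n).-1 = n + 11)%N; last by lia.
have := geometric_decay R n; rewrite addnC -addSn -!exprVn !exprD => n_le.
have : 0 <= 2^-1 ^+ n :> R by rewrite exprn_ge0 // invr_ge0.
by lra.
Qed.

Lemma pow2_le_32 (R : realType) (h : nat) : (5 <= h)%N -> 2 ^- h <= 1 / 32 :> R.
Proof.
move=> h5; have -> : 1 / 32 = 2 ^- 5 :> R by lra.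
by rewrite lef_pV2 ?posrE ?exprn_gt0 // ler_eXn2l // ltr1n.
Qed.

(** * Deviations and nested boxes *)

Definition deviation (R : realType) (E : finType) (N : nat) (x : 'I_N -> E)
    (B : {set E}) : R :=
  N%:R^-1 * (\sum_(n < N) (x n \in B)%:R) - density R B.

Lemma deviation0 (R : realType) (E : finType) (N : nat) (x : 'I_N -> E) :
  deviation R x finset.set0 = 0.
Proof.
rewrite /deviation big1 ?mulr0 => [|n _]; last by rewrite inE.
by rewrite densityE cards0 mul0r subr0.
Qed.

Lemma deviationD (R : realType) (E : finType) (N : nat) (x : 'I_N -> E)
    (B C : {set E}) : C \subset B ->
  deviation R x B = deviation R x (B :\: C)%SET + deviation R x C.
Proof.
move=> CB; rewrite /deviation densityD // addrACA -mulrDr -big_split /=.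
have -> : \sum_(n < N) ((x n \in (B :\: C)%SET)%:R + (x n \in C)%:R)
    = \sum_(n < N) (x n \in B)%:R :> R.
  apply: eq_bigr => n _; rewrite inE -natrD; congr _%:R.
  by have := fintype.subsetP CB (x n); case: (x n \in C); case: (x n \in B) => // /(_ isT).
by ring.
Qed.

Section Cells.
Variables (R : realType) (F : finFieldType) (d : nat) (iot : F -> 'I_#|F|).
Hypotheses (iot_bij : bijective iot) (d_gt0 : (0 < d)%N).

(** Boxes are indexed by natural exponents: a step of the exponents multiplies
    the volume by [exp(- 1 / (d 2 ^ h))] whichever coordinate it concerns. *)
Definition corner (h : nat) (a : 'I_d -> nat) (j : 'I_d) : R :=
  expR (- ((a j)%:R / (d%:R * 2 ^+ h))).

(** At this sum of exponents the volume is [exp(- (h - 1))], below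
    [2 ^ - h] from level 5 on; smaller boxes are replaced by the empty set, which keeps the
    families finite. *)
Definition cutoff (h : nat) : nat := d * (2 ^ h * h.-1).

Definition cell (h : nat) (a : 'I_d -> nat) : {set 'rV[F]_d} :=
  if (\sum_j a j <= cutoff h)%N then below iot (corner h a) else finset.set0.

(** Doubling the scale halves the exponents; rounding up makes the coarser box
    smaller. *)
Definition coarsen (a : 'I_d -> nat) (j : 'I_d) : nat := uphalf (a j).

Let dR_gt0 : 0 < d%:R :> R. Proof. by rewrite ltr0n. Qed.
Let scale_gt0 (h : nat) : 0 < d%:R * 2 ^+ h :> R.
Proof. by rewrite mulr_gt0 // exprn_gt0. Qed.

Lemma corner01 (h : nat) (a : 'I_d -> nat) (j : 'I_d) : 0 <= corner h a j <= 1.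
Proof. by rewrite expR_ge0 expR_le1 oppr_le0 divr_ge0 // ltW. Qed.

Lemma prod_corner (h : nat) (a : 'I_d -> nat) :
  \prod_j corner h a j = expR (- ((\sum_j a j)%:R / (d%:R * 2 ^+ h))).
Proof. by rewrite -expR_sum sumrN -mulr_suml -natr_sum. Qed.

Lemma prod_corner_cutoff (h : nat) (a : 'I_d -> nat) (x : R) :
  (cutoff h)%:R - x * (d%:R * 2 ^+ h) <= (\sum_j a j)%:R ->
  \prod_j corner h a j <= expR (x - h.-1%:R).
Proof.
move=> ax; rewrite prod_corner ler_expR -opprB lerN2 ler_pdivlMr //.
by apply: le_trans ax; rewrite /cutoff !natrM natrX; lra.
Qed.

Lemma corner_half (h : nat) (a : 'I_d -> nat) (j : 'I_d) :
  corner h (coarsen a) j <= corner h.+1 a j.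
Proof.
rewrite ler_expR lerN2 exprS mulrCA invfM mulrA.
apply: ler_wpM2r; first by rewrite invr_ge0 ltW.
rewrite ler_pdivrMr // -natrM ler_nat /coarsen.
by have := odd_double_half (a j); rewrite uphalf_half; lia.
Qed.

Lemma cell_half (h : nat) (a : 'I_d -> nat) :
  (\sum_j a j <= cutoff h.+1)%N -> cell h (coarsen a) \subset cell h.+1 a.
Proof.
move=> aM; rewrite /cell aM; case: ifP => _; last exact: finset.sub0set.
by apply: subset_below => j; exact: corner_half.
Qed.

Lemma sum_half (a : 'I_d -> nat) :
  (\sum_j a j <= 2 * \sum_j coarsen a j <= \sum_j a j + d)%N.
Proof.
rewrite big_distrr /= -[in X in (_ + X)%N](card_ord d) -sum1_card -big_split /=.
by apply/andP; split; apply: leq_sum => j _; rewrite /coarsen uphalf_half;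
  have := odd_double_half (a j); lia.
Qed.

(** Rounding costs at most 1 in each of the [d] doubled exponents, that is a
    factor [exp(- 2 ^ -(h + 1))] in volume. If the coarse box is empty, the
    fine one is itself small, being just above the cutoff. *)
Lemma density_cell_half (h : nat) (a : 'I_d -> nat) :
  (12 <= h)%N -> (\sum_j a j <= cutoff h.+1)%N ->
  density R (cell h.+1 a :\: cell h (coarsen a))%SET <= 2 ^- h.+1 + d%:R / #|F|%:R.
Proof.
move=> h12 aM; rewrite densityD ?cell_half // /cell aM.
have /andP[_ upper] := density_below iot_bij (corner01 h.+1 a).
have /andP[_ half_le] := sum_half a.
have dD : d%:R = 2 ^- h.+1 * (d%:R * 2 ^+ h.+1) :> R.
  by rewrite mulrC -mulrA divff ?mulr1 // expf_neq0.
case: leqP => halfM.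
  have /andP[lower _] := density_below iot_bij (corner01 h (coarsen a)).
  suff : \prod_j corner h.+1 a j - 2 ^- h.+1 <= \prod_j corner h (coarsen a) j by lra.
  have w1 : \prod_j corner h.+1 a j <= 1.
    by rewrite prod_corner expR_le1 oppr_le0 divr_ge0 // ltW.
  have step : expR (- 2 ^- h.+1) * \prod_j corner h.+1 a j
      <= \prod_j corner h (coarsen a) j.
    rewrite !prod_corner -expRD ler_expR -opprD lerN2 ler_pdivrMr //.
    rewrite mulrDl [X in _ <= _ + X]mulrAC.
    have -> : 2 ^- h.+1 * (d%:R * 2 ^+ h) = d%:R / 2 :> R.
      by rewrite exprS; field; rewrite ?expf_neq0.
    have -> : (\sum_j a j)%:R * (d%:R * 2 ^+ h) / (d%:R * 2 ^+ h.+1)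
        = (\sum_j a j)%:R / 2 :> R.
      by rewrite exprS; field; rewrite ?expf_neq0 // gt_eqF.
    move: half_le; rewrite -(ler_nat R) natrM natrD; lra.
  apply: le_trans step; have := expR_ge1Dx (- 2 ^- h.+1 : R).
  have e_gt0 : 0 <= 2 ^- h.+1 :> R by rewrite invr_ge0 exprn_ge0.
  have w0 : 0 <= \prod_j corner h.+1 a j by rewrite prod_corner expR_ge0.
  nra.
rewrite [density R finset.set0]densityE cards0 mul0r subr0; apply: le_trans upper _; rewrite lerD2r.
apply: (@le_trans _ _ (expR (2 ^- h.+1 - h.-1%:R))); last first.
  by apply: cutoff_decay_strong => //; apply: pow2_le_32; lia.
have : (cutoff h)%:R + 1 <= (\sum_j coarsen a j)%:R :> R by rewrite natr1 ler_nat.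
rewrite prod_corner ler_expR -opprB lerN2 ler_pdivlMr // mulrBl -dD.
move: half_le; rewrite -(ler_nat R) natrM natrD /cutoff !natrM natrX exprS; lra.
Qed.
End Cells.

(** The tail bound for the centred indicator of [B], of variance [p (1 - p)]. *)
Lemma deviation_tail (R : realType) (E T : finType) (k N m : nat) (X : T -> 'I_N -> E)
    (B : {set E}) (sig2 tau : R) :
  (minn N (2 * m) <= k <= N)%N -> (0 < #|E|)%N -> (0 < N)%N ->
  index_one_orthogonal_array k X ->
  density R B * (1 - density R B) <= sig2 ->
  (0 < m)%N -> m%:R <= N%:R * sig2 -> 0 <= tau -> 6 * m%:R * sig2 <= tau ^+ 2 * N%:R ->
  average (fun s => (tau <= `|deviation R (X s) B|)%R%:R : R) <= 2 * 4^-1 ^+ m.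
Proof.
move=> kN E_gt0 N_gt0 Xoa var m_gt0 m_le tau_ge0 tau2.
have NR : 0 < N%:R :> R by rewrite ltr0n.
set p := density R B in var.
pose f e : R := (e \in B)%:R - p.
have p0 : 0 <= p by exact: density_ge0.
have p1 : p <= 1 by exact: density_le1.
have f_le1 e : `|f e| <= 1 by rewrite /f ler_norml; case: (e \in B) => /=; lra.
have f0 : average f = 0.
  by rewrite /f averageD average_cst // -/(density R B) -/p subrr.
have f2 : average (fun e => f e ^+ 2) <= sig2.
  apply: le_trans var; rewrite le_eqVlt; apply/orP; left; apply/eqP.
  transitivity (average (fun e => (1 - 2 * p) * (e \in B)%:R + p ^+ 2)).
    by apply: eq_average => e; rewrite /f; case: (e \in B) => /=; ring.
  by rewrite averageD averageZ average_cst // -/(density R B) -/p; ring.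
have tN0 : 0 <= tau * N%:R by rewrite mulr_ge0 // ltW.
have tN2 : 6 * m%:R * (N%:R * sig2) <= (tau * N%:R) ^+ 2.
  have -> : 6 * m%:R * (N%:R * sig2) = 6 * m%:R * sig2 * N%:R by ring.
  have -> : (tau * N%:R) ^+ 2 = tau ^+ 2 * N%:R * N%:R by ring.
  by apply: ler_wpM2r => //; exact: ltW.
apply: le_trans (tail_bound kN E_gt0 Xoa f_le1 f0 f2 m_gt0 m_le tN0 tN2).
apply: le_average => s; rewrite ler_nat.
suff -> : `|\sum_n f (X s n)| = `|deviation R (X s) B| * N%:R.
  by rewrite ler_pM2r.
rewrite -[X in _ = _ * X]ger0_norm ?ltW // -normrM /deviation mulrBl mulrC mulrA
  divff ?gt_eqF // mul1r.
by rewrite /f sumrB sumr_const card_ord -[_ *+ N]mulr_natr.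
Qed.

Lemma average_exists (R : realType) (T I : finType) (P : I -> T -> bool) :
  average (fun s => [exists i, P i s]%:R : R) <= \sum_i average (fun s => (P i s)%:R : R).
Proof.
rewrite -average_sum; apply: le_average => s.
case: existsP => [[i Pi]|_]; last by apply: sumr_ge0.
by rewrite (bigD1 i) //= Pi lerDl sumr_ge0.
Qed.

Section Chaining.
Variables (R : realType) (F : finFieldType) (d : nat) (iot : F -> 'I_#|F|).
Hypotheses (iot_bij : bijective iot) (d_gt0 : (0 < d)%N).
Variable h0 : nat.
Local Notation cell := (cell R iot).

(** The summands of the chain: a box of the first level [h0], then the part that
    each refinement adds. *)
Definition piece (i : nat) (a : 'I_d -> nat) : {set 'rV[F]_d} :=
  if i is i'.+1 then (cell (h0 + i) a :\: cell (h0 + i') (coarsen a))%SET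
  else cell h0 a.

(** Deviations are additive on disjoint unions, and following [a] down the levels
    by repeated coarsening exhibits the last box as such a union of pieces. *)
Lemma deviation_chain (N : nat) (x : 'I_N -> 'rV[F]_d) (n : nat) (tau : nat -> R) :
  (forall i, 0 <= tau i) ->
  (forall i a, (i <= n)%N -> (\sum_j a j <= cutoff d (h0 + i))%N ->
    `|deviation R x (piece i a)| <= tau i) ->
  forall a, `|deviation R x (cell (h0 + n) a)| <= \sum_(i < n.+1) tau i.
Proof.
move=> tau_ge0; elim: n => [|n IHn] dev_le a.
  rewrite big_ord1 addn0; have [aM|aM] := boolP (\sum_j a j <= cutoff d h0)%N.
    by apply: (dev_le 0%N) => //; rewrite addn0.
  by rewrite /cell (negbTE aM) deviation0 normr0.
have [aM|aM] := boolP (\sum_j a j <= cutoff d (h0 + n.+1))%N; last first.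
  by rewrite /cell (negbTE aM) deviation0 normr0 sumr_ge0.
rewrite big_ord_recr /= (@deviationD _ _ _ _ _ (cell (h0 + n) (coarsen a))).
  apply: le_trans (ler_normD _ _) _; rewrite [leLHS]addrC; apply: lerD.
    by apply: IHn => i b i_le; apply: dev_le; exact: leqW.
  exact: (dev_le n.+1).
by rewrite addnS; apply: cell_half => //; rewrite -addnS.
Qed.

(** A box with positive sides is squeezed between the boxes obtained by
    rounding the logarithms of its sides to multiples of [1 / (d 2 ^ K)]. When
    one of these is too small to belong to the family, the box itself has volume at most
    [2 ^ - K]: from below [0] is then a good enough estimate of the proportion of
    points, and from above the box is enlarged up to the cutoff. *)
Lemma local_discrepancy_le (N : nat) (x : 'I_N -> 'rV[F]_d) (K : nat) (T : R)
    (z : 'I_d -> R) :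
  (0 < N)%N -> (5 <= K)%N ->
  (forall a, `|deviation R x (cell K a)| <= T) -> (forall j, 0 <= z j <= 1) ->
  `|N%:R^-1 * (\sum_(n < N) (x n \in below iot z)%:R) - \prod_j z j|
    <= T + 2 ^- K + d%:R / #|F|%:R.
Proof.
move=> N_gt0 K5 dev_le z01.
have NR : 0 < N%:R :> R by rewrite ltr0n.
have T_ge0 : 0 <= T by apply: le_trans (dev_le (fun=> 0%N)).
have dq_ge0 : 0 <= d%:R / #|F|%:R :> R by rewrite divr_ge0.
have pK_ge0 : 0 <= 2 ^- K :> R by rewrite invr_ge0 exprn_ge0.
pose emp (B : {set 'rV[F]_d}) : R := N%:R^-1 * (\sum_(n < N) (x n \in B)%:R).
have emp_ge0 B : 0 <= emp B by rewrite mulr_ge0 ?invr_ge0 ?sumr_ge0 // ltW.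
have emp_le (B C : {set 'rV[F]_d}) : B \subset C -> emp B <= emp C.
  move=> /fintype.subsetP BC; apply: ler_wpM2l; first by rewrite invr_ge0 ltW.
  by apply: ler_sum => n _; rewrite ler_nat; have := BC (x n);
    case: (_ \in B) => // ->.
(* A box with a side of length 0 is empty and has volume 0. *)
rewrite -/(emp _); have [/existsP[j0 /eqP zj0]|] := boolP [exists j, z j == 0].
  rewrite /emp big1 => [|n _].
    by rewrite mulr0 (bigD1 j0) //= zj0 mul0r subrr normr0 !addr_ge0.
  rewrite inE; case: forallP => // /(_ j0); rewrite zj0 ltNge.
  by rewrite divr_ge0.
(* Floor for the outer box; its successor is a valid inner exponent also when
   the logarithm is an exact multiple. *)
move=> /existsPn z_n0.
have z_gt0 j : 0 < z j by rewrite lt_neqAle eq_sym z_n0; case/andP: (z01 j).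
pose D : R := d%:R * 2 ^+ K.
have D_gt0 : 0 < D by rewrite mulr_gt0 ?ltr0n // exprn_gt0.
pose b j := Num.trunc (- ln (z j) * D).
pose a j := (b j).+1.
have bP j : (b j)%:R <= - ln (z j) * D < (a j)%:R.
  apply: truncn_itv; rewrite mulr_ge0 ?(ltW D_gt0) // oppr_ge0 ln_le0 //.
  by case/andP: (z01 j).
have az j : corner R K a j <= z j.
  rewrite -[leRHS]lnK ?posrE // ler_expR lerNl ler_pdivlMr // ltW //.
  by have /andP[] := bP j.
have zb j : z j <= corner R K b j.
  rewrite -[leLHS]lnK ?posrE // ler_expR lerNr ler_pdivrMr //.
  by have /andP[] := bP j.
have sab : (\sum_j a j = \sum_j b j + d)%N.
  under eq_bigr => j _ do rewrite /a -addn1.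
  by rewrite big_split /= sum1_card card_ord.
set P := \prod_j z j.
have VP : \prod_j corner R K a j <= P.
  by apply: ler_prod => j _; rewrite expR_ge0 az.
have PW : P <= \prod_j corner R K b j.
  by apply: ler_prod => j _; rewrite zb ltW.
have W1 : \prod_j corner R K b j <= 1.
  by rewrite prod_corner expR_le1 oppr_le0 divr_ge0 // ltW.
have WV : \prod_j corner R K b j - 2 ^- K <= \prod_j corner R K a j.
  have -> : \prod_j corner R K a j = expR (- 2 ^- K) * \prod_j corner R K b j.
    rewrite !prod_corner -expRD sab natrD; congr expR; rewrite -/D.
    have -> : 2 ^- K = d%:R / D.
      by rewrite /D invfM mulrA divff ?mul1r // gt_eqF // ltr0n.
    by rewrite mulrDl opprD addrC.
  have := expR_ge1Dx (- 2 ^- K : R).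
  have : 0 <= \prod_j corner R K b j by rewrite prod_corner expR_ge0.
  nra.
have emp_cell c : - T <= emp (cell K c) - density R (cell K c) <= T.
  by rewrite -ler_norml; exact: dev_le.
have low : P - (T + 2 ^- K) <= emp (below iot z).
  have [aM|aM] := boolP (\sum_j a j <= cutoff d K)%N.
    have /andP[lo _] := emp_cell a; move: lo; rewrite /cell aM.
    have := emp_le _ _ (subset_below iot az).
    have /andP[] := density_below iot_bij (corner01 R K a).
    lra.
  have : P <= 2 ^- K.
    apply: le_trans PW _; apply: le_trans (cutoff_decay K5 (pow2_le_32 R K5)).
    apply: prod_corner_cutoff => //.
    rewrite mulrCA mulVf ?mulr1 ?expf_neq0 // lerBlDr -natrD ler_nat -sab.
    by rewrite ltnW // ltnNge.
  have := emp_ge0 (below iot z); lra.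
have high : emp (below iot z) <= P + T + 2 ^- K + d%:R / #|F|%:R.
  have [bM|bM] := leqP (\sum_j b j) (cutoff d K).
    have /andP[_ hi] := emp_cell b; move: hi; rewrite /cell bM.
    have := emp_le _ _ (subset_below iot zb).
    have /andP[] := density_below iot_bij (corner01 R K b).
    lra.
  have [c cb sc] := lower_sum (ltnW bM).
  have zc j : z j <= corner R K c j.
    apply: le_trans (zb j) _; rewrite ler_expR lerN2 ler_wpM2r ?invr_ge0 ?(ltW D_gt0) //.
    by rewrite ler_nat.
  have /andP[_ hi] := emp_cell c; move: hi; rewrite /cell sc leqnn.
  have := emp_le _ _ (subset_below iot zc).
  have /andP[_] := density_below iot_bij (corner01 R K c).
  have : \prod_j corner R K c j <= 2 ^- K.
    apply: (@le_trans _ _ (expR (0 - K.-1%:R))).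
      by apply: prod_corner_cutoff; rewrite // mul0r subr0 sc.
    by apply: cutoff_decay => //; lra.
  have : 0 <= P by apply: prodr_ge0 => j _; exact: ltW.
  lra.
by rewrite ler_norml; apply/andP; split; lra.
Qed.

End Chaining.

(** * The union bound over all levels *)

Lemma sum_inv_pow2 (R : realType) (n : nat) : \sum_(i < n) 2 ^- i.+1 <= 1 :> R.
Proof.
suff -> : \sum_(i < n) 2 ^- i.+1 = 1 - 2 ^- n :> R.
  by rewrite gerBl invr_ge0 exprn_ge0.
elim: n => [|n IHn]; first by rewrite big_ord0 expr0 invr1 subrr.
rewrite big_ord_recr /= IHn -!exprVn exprS; lra.
Qed.

(** Unless some piece at some level deviates by more than its allowance, the
    seed is good; the failures of level [i] have total proportion at most
    [(1 - u) / 2 ^ (h0 + i)]. *)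
Lemma chaining_average (R : realType) (F : finFieldType) (d N k h0 n : nat)
    (iot : F -> 'I_#|F|) (xi : 'I_N -> F) (m : nat -> nat) (sig2 tau : nat -> R)
    (u : R) (good : pred {ffun 'I_k -> 'rV[F]_d}) :
  (0 < d)%N -> (0 < N)%N -> (1 < h0)%N -> injective xi -> u <= 1 ->
  (forall i, (i <= n)%N -> (minn N (2 * m i) <= k <= N)%N) ->
  (forall i, (i <= n)%N -> (0 < m i)%N) ->
  (forall i, (i <= n)%N -> (m i)%:R <= N%:R * sig2 i) ->
  (forall i, 0 <= tau i) ->
  (forall i, (i <= n)%N -> 6 * (m i)%:R * sig2 i <= tau i ^+ 2 * N%:R) ->
  (forall i (a : 'I_d -> nat), (i <= n)%N -> (\sum_j a j <= cutoff d (h0 + i))%N ->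
    density R (piece R iot h0 i a) * (1 - density R (piece R iot h0 i a)) <= sig2 i) ->
  (forall i, (i <= n)%N ->
    (expR 1 * (2 ^ (h0 + i) * (h0 + i).-1).+1%:R) ^+ d * (2 * 4^-1 ^+ m i)
      <= (1 - u) * 2 ^- (h0 + i)) ->
  (forall A : {ffun 'I_k -> 'rV[F]_d},
    (forall i (a : 'I_d -> nat), (i <= n)%N ->
      (\sum_j a j <= cutoff d (h0 + i))%N ->
      `|deviation R (fun l => vector_poly_eval A (xi l)) (piece R iot h0 i a)| <= tau i) ->
    good A) ->
  u <= average (fun A => (good A)%:R : R).
Proof.
move=> d_gt0 N_gt0 h0_gt0 xi_inj u1 kN m_gt0 m_le tau_ge0 tau2 var fail goodP.
have V_gt0 : (0 < #|'rV[F]_d|)%N by apply/card_gt0P; exists 0.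
pose X (A : {ffun 'I_k -> 'rV[F]_d}) l := vector_poly_eval A (xi l).
have Xoa : index_one_orthogonal_array k X by exact: polynomial_orthogonal_array.
pose ev (i : nat) (f : {ffun 'I_d -> 'I_(cutoff d (h0 + i)).+1}) A :=
  (\sum_j f j <= cutoff d (h0 + i))%N
    && (tau i <= `|deviation R (X A) (piece R iot h0 i (fun j => f j))|).
pose bad A := [exists i : 'I_n.+1, [exists f, ev i f A]].
have bad_le : average (fun A => (bad A)%:R : R) <= 1 - u.
  apply: le_trans (average_exists _ _) _.
  apply: (@le_trans _ _ (\sum_(i < n.+1) (1 - u) * 2 ^- i.+1)); last first.
    by rewrite -mulr_sumr ler_piMr ?subr_ge0 // sum_inv_pow2.
  apply: ler_sum => i _; have i_le : (i <= n)%N by rewrite -ltnS.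
  apply: le_trans (average_exists _ _) _.
  apply: (@le_trans _ _ ((1 - u) * 2 ^- (h0 + i))); last first.
    rewrite ler_wpM2l ?subr_ge0 // lef_pV2 ?posrE ?exprn_gt0 //.
    by rewrite ler_eXn2l ?ltr1n //; lia.
  apply: le_trans (fail i i_le).
  apply: (@le_trans _ _ (\sum_(f : {ffun 'I_d -> 'I_(cutoff d (h0 + i)).+1}
      | (\sum_j f j <= cutoff d (h0 + i))%N) (2 * 4^-1 ^+ m i))).
    rewrite [leRHS]big_mkcond; apply: ler_sum => f _; case: ifP => fM; last first.
      rewrite /ev fM /= /average big1 ?mul0r // => s _.
    under eq_average do rewrite /ev fM /=.
    exact: deviation_tail (kN i i_le) V_gt0 N_gt0 Xoa (var i _ i_le fM)
      (m_gt0 i i_le) (m_le i i_le) (tau_ge0 i) (tau2 i i_le).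
  rewrite sumr_const -[leLHS]mulr_natl; apply: ler_wpM2r.
    by rewrite mulr_ge0 // exprn_ge0 // invr_ge0.
  rewrite (_ : #|_| = #|[set f : {ffun 'I_d -> 'I_(cutoff d (h0 + i)).+1}
      | (\sum_j f j <= cutoff d (h0 + i))%N]%SET|); last first.
    by apply: eq_card => f; rewrite !inE.
  by apply: card_bounded_sum; rewrite muln_gt0 expn_gt0 /=; lia.
apply: (@le_trans _ _ (average (fun A => 1 - (bad A)%:R))); last first.
  apply: le_average => A; have [_|nbad] := boolP (bad A); first by rewrite subrr.
  rewrite subr0 (_ : good A) //; apply: goodP => i a i_le aM; rewrite leNgt.
  apply: contra nbad => /ltW tau_le.
  have a_lt j : (a j < (cutoff d (h0 + i)).+1)%N.
    by rewrite ltnS (leq_trans _ aM) // (bigD1 j) //= leq_addr.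
  apply/existsP; exists (Ordinal (i_le : (i < n.+1)%N)); apply/existsP.
  exists [ffun j => Ordinal (a_lt j)]; rewrite /ev.
  under eq_bigr do rewrite ffunE /=.
  rewrite aM /= (_ : (fun j => _) = a) //.
  by apply/funext => j; rewrite ffunE.
have T_gt0 : (0 < #|{ffun 'I_k -> 'rV[F]_d}|)%N.
  by rewrite card_ffun expn_gt0 V_gt0.
rewrite averageD average_cst //.
have -> : average (fun A => - (bad A)%:R) = - average (fun A => (bad A)%:R : R).
  by rewrite /average sumrN mulNr.
by lra.
Qed.

Section MomentOrder.
Variables (R : realType) (d : nat) (u : R).
Hypothesis (u01 : 0 < u < 1).

Definition log_failure : R := ln ((1 - u)^-1).

(** Half the order of the moment used at level [h]. The summand [1] in
    [1 + h ln 2] pays for the factor [e ^ d] in the number of boxes, and the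
    extra factor 1 in [d + 1] makes the failures summable over [h]. *)
Definition moment_order (h : nat) : nat :=
  `|Num.ceil (d.+1%:R * (1 + h%:R * ln 2) + log_failure)|%N.

Let u_gt0 : 0 < u. Proof. by case/andP: u01. Qed.
Let u_lt1 : 0 < 1 - u. Proof. by rewrite subr_gt0; case/andP: u01. Qed.

Lemma log_failure_ge0 : 0 <= log_failure.
Proof. by rewrite ln_ge0 // invf_ge1 // gerBl ltW. Qed.

Lemma entropy_bounds (h : nat) : 1 <= 1 + h%:R * ln (2 : R) <= 1 + h%:R * (7 / 10).
Proof.
have /andP[l2 u2] := ln2_bounds R.
have h_ge0 : 0 <= h%:R :> R by [].
by rewrite lerDl lerD2l; apply/andP; split; [rewrite mulr_ge0 //; lra|exact: ler_wpM2l].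
Qed.

Lemma moment_order_bounds (h : nat) :
  d.+1%:R * (1 + h%:R * ln 2) + log_failure <= (moment_order h)%:R
    <= (1 + h%:R * ln 2) * paramD d u.
Proof.
have L_ge0 := log_failure_ge0; have /andP[k_ge1 _] := entropy_bounds h.
set kap := 1 + _ in k_ge1 *; rewrite /moment_order -/kap.
have d_ge0 : 0 <= d%:R :> R by [].
set x := _ + log_failure.
have x_ge0 : 0 <= x by rewrite addr_ge0 // mulr_ge0 //; lra.
have /andP[c_lo c_hi] := ceil_itv x.
have -> : (`|Num.ceil x|%N)%:R = (Num.ceil x)%:~R :> R.
  by rewrite natr_absz ger0_norm // ceil_ge0; lra.
rewrite c_hi /=; move: c_lo; rewrite intrB /= ltrBlDr => c_lo.
apply: le_trans (ltW c_lo) _; rewrite /x /paramD -/log_failure -natr1.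
have : 0 <= (kap - 1) * log_failure by rewrite mulr_ge0 // subr_ge0.
nra.
Qed.

Lemma moment_order_gt0 (h : nat) : (0 < moment_order h)%N.
Proof.
rewrite -(ltr0n R); have /andP[] := moment_order_bounds h; move=> + _.
apply: lt_le_trans; have L_ge0 := log_failure_ge0.
have /andP[k_ge1 _] := entropy_bounds h.
have : 0 <= d%:R :> R by [].
by rewrite -natr1; nra.
Qed.

Lemma moment_order_mono (h h' : nat) :
  (h <= h')%N -> (moment_order h <= moment_order h')%N.
Proof.
move=> hh'; have L_ge0 := log_failure_ge0.
have /andP[l2 _] := ln2_bounds R.
have x_ge0 (l : nat) : 0 <= d.+1%:R * (1 + l%:R * ln 2) + log_failure.
  have /andP[k_ge1 _] := entropy_bounds l.
  by rewrite addr_ge0 // mulr_ge0 //; lra.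
rewrite -lez_nat !gez0_abs ?ceil_ge0 ?(lt_le_trans _ (x_ge0 _)) //.
apply: le_ceil; rewrite lerD2r ler_wpM2l // lerD2l ler_wpM2r ?ler_nat //; lra.
Qed.

(** Here [5 / 2] is a lower bound for [4 ^ (ln 2)], and [3] an upper bound for [e]. *)
Lemma polynomial_growth (h : nat) :
  (5 <= h)%N -> 3 * (2 ^ h * h.-1).+1%:R <= 4 * (5 / 2) ^+ h :> R.
Proof.
have cellE (l : nat) : (2 ^ l * l.-1).+1%:R = 2 ^+ l * l.-1%:R + 1 :> R.
  by rewrite -natr1 natrM natrX.
rewrite cellE => /subnKC <-; elim: (h - 5)%N => [|n]; first by rewrite /=; lra.
rewrite addnS exprS [in X in _ -> _ <= X]exprS /=.
set y := 2 ^+ (5 + n); have y_ge1 : 1 <= y :> R by rewrite exprn_ege1 // ler1n.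
have -> : (5 + n).-1%:R = 4 + n%:R :> R by rewrite -natrD.
have -> : (5 + n)%:R = 5 + n%:R :> R by rewrite natrD.
have : 0 <= y * n%:R by rewrite mulr_ge0 //; lra.
by set z := (5 / 2) ^+ (5 + n); lra.
Qed.

(** With [G = 4 ^ (1 + h ln 2)], the boxes number at most [G ^ d], while
    [4 ^ - m_h <= G ^ -(d + 1) (1 - u)]; the remaining factor [2 / G] is at most
    [2 ^ - h]. *)
Lemma union_bound_level (h : nat) : (5 <= h)%N ->
  (expR 1 * (2 ^ h * h.-1).+1%:R) ^+ d * (2 * 4^-1 ^+ moment_order h)
    <= (1 - u) * 2 ^- h.
Proof.
move=> h5; have L_ge0 := log_failure_ge0.
have /andP[l2 _] := ln2_bounds R.
set kap : R := 1 + h%:R * ln 2; pose G := expR (2 * ln 2 * kap).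
have ln4 : expR (2 * ln 2) = 4 :> R.
  by rewrite -[2 * ln 2]mulrC expRM_natr lnK ?posrE //; lra.
have GE : G = 4 * expR (2 * ln 2 * ln 2) ^+ h.
  rewrite /G /kap mulrDr mulr1 expRD ln4; congr (_ * _).
  by rewrite -expRM_natr; congr expR; ring.
have G_ge : 4 * (5 / 2) ^+ h <= G.
  by rewrite GE ler_wpM2l //; apply: lerXn2r; rewrite ?nnegrE ?expR_ge0 ?expR_ln4_ln2 //; lra.
have G_gt0 : 0 < G by exact: expR_gt0.
have cover_le : expR 1 * (2 ^ h * h.-1).+1%:R <= G.
  apply: le_trans G_ge; apply: le_trans (polynomial_growth h5).
  by rewrite ler_wpM2r //; case/andP: (expR1_bounds R).
have G_pow : 2 * 2 ^+ h <= G.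
  apply: le_trans G_ge; have : 2 ^+ h <= (5 / 2) ^+ h :> R.
    by apply: lerXn2r; rewrite ?nnegrE; lra.
  have : 0 <= 2 ^+ h :> R by rewrite exprn_ge0.
  lra.
have four_le : 4^-1 ^+ moment_order h <= G ^- d.+1 * (1 - u).
  have -> : 4^-1 ^+ moment_order h = expR (- (2 * ln 2) * (moment_order h)%:R) :> R.
    by rewrite expRM_natr expRN ln4.
  have -> : 1 - u = expR (- log_failure).
    by rewrite /log_failure lnV ?posrE // opprK lnK ?posrE.
  have -> : G ^- d.+1 = expR (- (2 * ln 2) * (d.+1%:R * kap)).
    by rewrite -expRM_natr -expRN; congr expR; ring.
  rewrite -expRD ler_expR; have /andP[+ _] := moment_order_bounds h; rewrite -/kap.
  set M := (moment_order h)%:R; set Q := d.+1%:R * kap.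
  move=> MQ; have : 2 * ln 2 * (Q + log_failure) <= 2 * ln 2 * M.
    by rewrite ler_wpM2l //; lra.
  have : 0 <= (2 * ln 2 - 1) * log_failure by rewrite mulr_ge0 //; lra.
  lra.
apply: (@le_trans _ _ (G ^+ d * (2 * (G ^- d.+1 * (1 - u))))).
  apply: ler_pM.
  - by rewrite exprn_ge0 // mulr_ge0 ?expR_ge0.
  - by rewrite mulr_ge0 // exprn_ge0 // invr_ge0.
  - by apply: lerXn2r; rewrite ?nnegrE ?mulr_ge0 ?expR_ge0 // ltW.
  - by rewrite ler_wpM2l.
have -> : G ^+ d * (2 * (G ^- d.+1 * (1 - u))) = (1 - u) * (2 / G).
  by rewrite exprS; field; rewrite ?expf_neq0 ?gt_eqF.
apply: ler_wpM2l; first exact: ltW.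
by rewrite ler_pdivrMr // mulrC ler_pdivlMr ?exprn_gt0.
Qed.

End MomentOrder.

(** * From boxes to the star discrepancy *)

Lemma star_discrepancy_le (R : realType) (d N : nat) (x : 'I_N -> 'rV[R]_d) (c : R) :
  (forall z : 'rV[R]_d, (forall j, 0 <= z 0 j <= 1) -> `|local_discrepancy x z| <= c) ->
  star_discrepancy x <= c.
Proof.
move=> H; apply: ge_sup => [|_ [z z01 <-]]; last exact: H.
exists `|local_discrepancy x 0|; exists 0 => // j /=.
by rewrite mxE lexx ler01.
Qed.

Lemma local_discrepancy_polynomial (R : realType) (F : finFieldType) (d N k : nat)
    (iot : F -> 'I_#|F|) (xi : 'I_N -> F) (A : 'I_k -> 'rV[F]_d) (z : 'rV[R]_d) :
  local_discrepancy (polynomial_points R xi iot A) z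
  = N%:R^-1 * (\sum_(n < N) (vector_poly_eval A (xi n) \in below iot (z 0))%:R)
    - \prod_j z 0 j.
Proof.
rewrite /local_discrepancy; congr (_ * _ - _); apply: eq_bigr => n _.
rewrite indicE; congr (_%:R); congr nat_of_bool; apply/idP/idP.
  rewrite inE => xz; rewrite finset.inE; apply/forallP => j.
  by have /andP[_] := xz j; rewrite mxE.
rewrite finset.inE => /forallP xz; rewrite inE => j.
by rewrite mxE xz andbT divr_ge0.
Qed.

Lemma local_discrepancy_le1 (R : realType) (d N : nat) (x : 'I_N -> 'rV[R]_d)
    (z : 'rV[R]_d) :
  (0 < N)%N -> (forall j, 0 <= z 0 j <= 1) -> `|local_discrepancy x z| <= 1.
Proof.
move=> N_gt0 z01; have NR : 0 < N%:R :> R by rewrite ltr0n.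
have p0 : 0 <= \prod_j z 0 j by apply: prodr_ge0 => j _; case/andP: (z01 j).
have p1 : \prod_j z 0 j <= 1 by apply: prodr_ile1 => j _; exact: z01.
have e0 : 0 <= N%:R^-1 * (\sum_(n < N) \1_(anchored_box z) (x n)) :> R.
  apply: mulr_ge0; first by rewrite invr_ge0 ltW.
  by apply: sumr_ge0 => n _; rewrite indicE.
have e1 : N%:R^-1 * (\sum_(n < N) \1_(anchored_box z) (x n)) <= 1 :> R.
  rewrite mulrC ler_pdivrMr // mul1r.
  have -> : N%:R = \sum_(n < N) 1 :> R by rewrite sumr_const card_ord.
  by apply: ler_sum => n _; rewrite indicE; case: (_ \in _).
by rewrite /local_discrepancy ler_norml; apply/andP; split; lra.
Qed.

(** All quantities are measured in units of [s]: since [m_h <= (1 + h ln 2) D] and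
    [D = s ^ 2 N], an allowance [c_i s] meets the tail bound as soon as
    [6 (1 + h ln 2) sig2 <= c_i ^ 2]. The first level uses the variance bound
    [1 / 4], the later ones the density of the pieces. *)
Lemma chaining_star_discrepancy (R : realType) (F : finFieldType) (d N k h0 n : nat)
    (iot : F -> 'I_#|F|) (xi : 'I_N -> F) (u s : R) (sig2 c : nat -> R) :
  (0 < d)%N -> (0 < N)%N -> (N <= #|F|)%N -> 0 < u < 1 -> injective xi ->
  bijective iot -> (5 <= h0)%N -> 0 < s -> s ^+ 2 = paramD d u / N%:R ->
  (forall i, (i <= n)%N -> (minn N (2 * moment_order d u (h0 + i)) <= k <= N)%N) ->
  (forall i, 0 <= c i) ->
  (forall i, (i <= n)%N -> (1 + (h0 + i)%:R * (7 / 10)) * s ^+ 2 <= sig2 i) ->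
  (forall i, (i <= n)%N -> 6 * (1 + (h0 + i)%:R * (7 / 10)) * sig2 i <= c i ^+ 2) ->
  4^-1 <= sig2 0%N ->
  (forall i, (0 < i <= n)%N -> (12 <= h0)%N && (2 ^- (h0 + i) + s ^+ 2 <= sig2 i)) ->
  u <= average (fun A : {ffun 'I_k -> 'rV[F]_d} =>
    (star_discrepancy (polynomial_points R xi iot A)
      <= \sum_(i < n.+1) c i * s + 2 ^- (h0 + n) + s ^+ 2)%R%:R : R).
Proof.
move=> d_gt0 N_gt0 Nq u01 xi_inj iot_bij h0_ge s_gt0 s2 kN c_ge0 msig csig sig0 sigi.
have NR : 0 < N%:R :> R by rewrite ltr0n.
have qR : 0 < #|F|%:R :> R by rewrite ltr0n; apply: leq_trans Nq.
have L_ge0 := log_failure_ge0 u01.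
have D_gt0 : 0 < paramD d u.
  rewrite /paramD -/(log_failure u); have : 0 <= d%:R :> R by []; lra.
have dq_le : d%:R / #|F|%:R <= s ^+ 2.
  rewrite s2; apply: ler_pM; rewrite ?invr_ge0 //.
    by rewrite /paramD -/(log_failure u); lra.
  by rewrite lef_pV2 ?posrE // ler_nat.
have s2N : s ^+ 2 * N%:R = paramD d u by rewrite s2 divfK ?gt_eqF.
have m_le i : (moment_order d u (h0 + i))%:R
    <= (1 + (h0 + i)%:R * (7 / 10)) * paramD d u.
  have /andP[_ m1] := moment_order_bounds d u01 (h0 + i).
  apply: le_trans m1 _; rewrite ler_wpM2r ?(ltW D_gt0) //.
  by have /andP[] := entropy_bounds R (h0 + i).
have kap_gt0 i : 0 < 1 + (h0 + i)%:R * (7 / 10) :> R.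
  have : 0 <= (h0 + i)%:R :> R by []; lra.
have sig_ge0 i : (i <= n)%N -> 0 <= sig2 i.
  move=> i_le; apply: le_trans (msig i i_le).
  by rewrite mulr_ge0 ?sqr_ge0 // ltW.
apply: (chaining_average (N := N) (xi := xi) (iot := iot) (m := fun i => moment_order d u (h0 + i))
  (sig2 := sig2) (tau := fun i => c i * s) (n := n) (h0 := h0)) => //.
- exact: leq_trans h0_ge.
- by case/andP: u01 => _ u_lt1; exact: ltW.
- by move=> i _; exact: (moment_order_gt0 d u01).
- move=> i i_le; apply: le_trans (m_le i) _; rewrite -s2N [_ * (s ^+ 2 * _)]mulrA [leLHS]mulrC.
  by rewrite ler_wpM2l ?(ltW NR) // msig.
- by move=> i; rewrite mulr_ge0 ?c_ge0 // ltW.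
- move=> i i_le; rewrite exprMn -[leRHS]mulrA s2N.
  apply: (@le_trans _ _ (6 * (1 + (h0 + i)%:R * (7 / 10)) * sig2 i * paramD d u)).
    have := m_le i; have := sig_ge0 i i_le.
    set M := _%:R; set K := _ * paramD _ _; move=> S0 MK.
    have : M * sig2 i <= K * sig2 i by rewrite ler_wpM2r.
    by rewrite /K; lra.
  by rewrite ler_wpM2r ?(ltW D_gt0) // csig.
- move=> i a i_le aM; set p := density R _.
  have p0 : 0 <= p by exact: density_ge0.
  have p1 : p <= 1 by exact: density_le1.
  case: i => [|i] in i_le aM p p0 p1 *.
    apply: le_trans sig0; have : 0 <= (2 * p - 1) ^+ 2 by exact: sqr_ge0.
    by nra.
  have /andP[h12 sig_le] := sigi i.+1 i_le.
  apply: le_trans sig_le.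
  apply: (@le_trans _ _ p); first by rewrite ler_piMr // gerBl.
  have -> : p = density R (cell R iot (h0 + i).+1 a :\: cell R iot (h0 + i) (coarsen a))%SET.
    by rewrite /p /piece addnS.
  apply: (@le_trans _ _ (2 ^- (h0 + i).+1 + d%:R / #|F|%:R)).
    by apply: density_cell_half; rewrite ?(leq_trans h12) ?leq_addr // -addnS.
  by rewrite addnS lerD2l.
- by move=> i _; apply: union_bound_level => //; exact: leq_trans h0_ge (leq_addr _ _).
move=> A devA; apply: star_discrepancy_le => z z01.
rewrite local_discrepancy_polynomial.
have dev_le := deviation_chain d_gt0 (fun i => mulr_ge0 (c_ge0 i) (ltW s_gt0)) devA.
have K5 : (5 <= h0 + n)%N by exact: leq_trans h0_ge (leq_addr _ _).
apply: le_trans (local_discrepancy_le iot_bij d_gt0 N_gt0 K5 dev_le z01) _.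
by rewrite lerD2l.
Qed.

(** The quantity [log2(N / D) / 2] is [- log2 s]. *)
Lemma paramH_bounds (R : realType) (d N : nat) (u : R) :
  (0 < N)%N -> 0 < u < 1 ->
  let s := Num.sqrt (paramD d u / N%:R) in
  exists H : nat, [/\ paramH d N u = H%:Z, (12 <= H)%N, 2 ^- H <= s / 4
    & (12 < H)%N -> s / 8 <= 2 ^- H].
Proof.
move=> N_gt0 u01 s.
have NR : 0 < N%:R :> R by rewrite ltr0n.
have L_ge0 := log_failure_ge0 u01.
have D_gt0 : 0 < paramD d u.
  rewrite /paramD -/(log_failure u); have : 0 <= d%:R :> R by []; lra.
have s_gt0 : 0 < s by rewrite sqrtr_gt0 divr_gt0.
have /andP[l2 _] := ln2_bounds R.
set y := 2^-1 * log2 (N%:R / paramD d u).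
have sE : s = expR (- (y * ln 2)).
  have -> : - (y * ln 2) = ln s.
    have : ln (s ^+ 2) = - ln (N%:R / paramD d u).
      by rewrite sqr_sqrtr ?divr_ge0 ?ltW // -lnV ?posrE ?divr_gt0 // invf_div.
    rewrite lnXn // mulr2n /y /log2 mulrA divfK; first by lra.
    by rewrite gt_eqF //; lra.
  by rewrite lnK.
have powE (l : nat) : 2 ^- l = expR (- (l%:R * ln 2)) :> R.
  by rewrite expRN mulrC expRM_natr lnK ?posrE.
have s4 : s / 4 = expR (- ((y + 2) * ln 2)).
  have -> : 4^-1 = 2 ^- 2 :> R by lra.
  by rewrite sE powE -expRD; congr expR; ring.
have s8 : s / 8 = expR (- ((y + 3) * ln 2)).
  have -> : 8^-1 = 2 ^- 3 :> R by lra.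
  by rewrite sE powE -expRD; congr expR; ring.
have /andP[c_lo c_hi] := ceil_itv y.
have H_ge0 : 0 <= paramH d N u by rewrite le_max.
exists `|paramH d N u|%N; split.
- by rewrite gez0_abs.
- by rewrite -lez_nat gez0_abs // le_max lexx.
- rewrite s4 powE ler_expR lerN2; apply: ler_wpM2r; first by lra.
  have -> : (`|paramH d N u|%N)%:R = (paramH d N u)%:~R :> R.
    by rewrite natr_absz ger0_norm.
  apply: (@le_trans _ _ (Num.ceil y + 2)%:~R).
    by rewrite intrD lerD2r.
  by rewrite ler_int le_max lexx orbT.
- move=> H12; rewrite s8 powE ler_expR lerN2; apply: ler_wpM2r; first by lra.
  have -> : (`|paramH d N u|%N)%:R = (paramH d N u)%:~R :> R.
    by rewrite natr_absz ger0_norm.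
  have -> : paramH d N u = Num.ceil y + 2.
    move: H12; rewrite -ltz_nat gez0_abs // /paramH lt_max ltxx /= => H12.
    by apply/max_idPr; exact: ltW.
  by move: c_lo; rewrite intrB intrD /=; lra.
Qed.

(** * The choice of levels *)

(** The chain has levels above 12 only when [s <= 8 * 2 ^ - h]; this bound then
    makes [s ^ 2 (1 + 0.7 h)] smaller than the variance [2 ^ - h]. *)
Lemma entropy_pow2 (R : realType) (l : nat) :
  (13 <= l)%N -> (1 + l%:R * (7 / 10)) * 2 ^- l <= 1 / 64 :> R.
Proof.
move=> /subnKC <-; elim: (l - 13)%N => [|n]; first by rewrite addn0; lra.
rewrite addnS -!exprVn exprS -natr1.
have : 0 <= 2^-1 ^+ (13 + n) :> R by rewrite exprn_ge0 // invr_ge0.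
have : 0 <= (13 + n)%:R :> R by [].
set x := (13 + n)%:R; set p := 2^-1 ^+ _ => x0 p0.
have : 0 <= x * p by rewrite mulr_ge0.
by lra.
Qed.

Lemma nine_eighths_pow (R : realType) (n : nat) : 1 + n%:R / 8 <= (9 / 8) ^+ n :> R.
Proof.
elim: n => [|n IHn]; first by rewrite mul0r addr0 expr0.
rewrite exprS -natr1; have : 0 <= n%:R :> R by [].
by lra.
Qed.

(** Since [94 / 25 = 3.76], its square exceeds [6 (1 + 12 * 0.7) / 4 = 14.1], as
    needed at level 12. The later variances decrease like [2 ^ - i] and the
    allowances like [(3 / 4) ^ i], whose square [(9 / 16) ^ i] decreases more
    slowly. *)
Definition chain_coef (R : realType) (i : nat) : R :=
  if i is j.+1 then 1 / 10 * (3 / 4) ^+ j else 94 / 25.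

(** The factor [11 / 10] leaves room for the grid error [s ^ 2]. *)
Definition chain_var (R : realType) (i : nat) : R :=
  if i is _.+1 then 11 / 10 * 2 ^- (12 + i) else 4^-1.

Lemma sum_chain_coef (R : realType) (n : nat) :
  \sum_(i < n.+1) chain_coef R i <= 94 / 25 + 4 / 10.
Proof.
rewrite big_ord_recl /= lerD2l -mulr_sumr.
suff : \sum_(i < n) (3 / 4) ^+ i <= 4 :> R by lra.
suff -> : \sum_(i < n) (3 / 4) ^+ i = 4 - 4 * (3 / 4) ^+ n :> R.
  by rewrite gerBl mulr_ge0 // exprn_ge0 // divr_ge0.
elim: n => [|n IHn]; first by rewrite big_ord0 expr0; lra.
by rewrite big_ord_recr /= IHn exprS; lra.
Qed.

Lemma chain_coef_var (R : realType) (i : nat) :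
  6 * (1 + (12 + i)%:R * (7 / 10)) * chain_var R i <= chain_coef R i ^+ 2.
Proof.
case: i => [|j]; first by rewrite /chain_coef /chain_var addn0; lra.
rewrite /chain_coef /chain_var exprMn -exprM mulnC exprM.
have -> : ((3 / 4) ^+ 2) ^+ j = (9 / 8) ^+ j * 2^-1 ^+ j :> R.
  by rewrite -exprMn; congr (_ ^+ _); lra.
rewrite (_ : (12 + j.+1 = 13 + j)%N) ?addnS // -exprVn exprD natrD.
have p0 : 0 <= 2^-1 ^+ j :> R by rewrite exprn_ge0 // invr_ge0.
have : (1 + j%:R / 8) * 2^-1 ^+ j <= (9 / 8) ^+ j * 2^-1 ^+ j :> R.
  by apply: ler_wpM2r => //; exact: nine_eighths_pow.
have : 0 <= j%:R * 2^-1 ^+ j :> R by rewrite mulr_ge0.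
by lra.
Qed.

Lemma param_k0_cover (R : realType) (d N H h : nat) (u : R) :
  0 < u < 1 -> paramH d N u = H%:Z -> (h <= H)%N ->
  (minn N (2 * moment_order d u h) <= param_k0 d N u <= N)%N.
Proof.
move=> u01 HE hH; rewrite /param_k0 HE geq_minl andbT.
rewrite -[absz _]/(moment_order d u H).
have := moment_order_mono d u01 hH; lia.
Qed.

(** Level 5 alone is usable for [s <= 2 / 9], where
    [(1 + 5 * 0.7) s ^ 2 <= 1 / 4] ensures [m_5 <= N / 4], and for [s >= 1 / 16],
    where [2 ^ -5 <= s / 2]. For smaller [s] the chain starts at level 12, whose
    moment order is then at most [N / 4] too. *)
Lemma star_discrepancy_average (R : realType) (F : finFieldType) (d N : nat)
    (iot : F -> 'I_#|F|) (xi : 'I_N -> F) (u : R) :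
  (0 < d)%N -> (0 < N)%N -> (N <= #|F|)%N -> 0 < u < 1 -> injective xi ->
  bijective iot ->
  u <= average (fun A : {ffun 'I_(param_k0 d N u) -> 'rV[F]_d} =>
    (star_discrepancy (polynomial_points R xi iot A)
      <= 9 / 2 * Num.sqrt (paramD d u / N%:R))%R%:R : R).
Proof.
move=> d_gt0 N_gt0 Nq u01 xi_inj iot_bij.
have [H [HE H12 Hs Hs8]] := paramH_bounds d N_gt0 u01.
set s := Num.sqrt _ in Hs Hs8 *.
have NR : 0 < N%:R :> R by rewrite ltr0n.
have L_ge0 := log_failure_ge0 u01.
have D_gt0 : 0 < paramD d u.
  rewrite /paramD -/(log_failure u); have : 0 <= d%:R :> R by []; lra.
have s_gt0 : 0 < s by rewrite sqrtr_gt0 divr_gt0.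
have s2 : s ^+ 2 = paramD d u / N%:R by rewrite sqr_sqrtr // divr_ge0 // ltW.
have [s_big|s_small] := leP (2 / 9) s.
  have V_gt0 : (0 < #|{ffun 'I_(param_k0 d N u) -> 'rV[F]_d}|)%N.
    by rewrite card_ffun expn_gt0; apply/orP; left; apply/card_gt0P; exists 0.
  rewrite (eq_average (g' := fun=> 1)) ?average_cst //; first by case/andP: u01 => _ /ltW.
  move=> A; rewrite (_ : _ <= _) //; apply: star_discrepancy_le => z z01.
  by apply: le_trans (local_discrepancy_le1 _ N_gt0 z01) _; lra.
have weaken (c : R) : c <= 9 / 2 * s ->
  u <= average (fun A : {ffun 'I_(param_k0 d N u) -> 'rV[F]_d} =>
    (star_discrepancy (polynomial_points R xi iot A) <= c)%R%:R : R) ->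
  u <= average (fun A : {ffun 'I_(param_k0 d N u) -> 'rV[F]_d} =>
    (star_discrepancy (polynomial_points R xi iot A) <= 9 / 2 * s)%R%:R : R).
  move=> c_le; move/le_trans; apply; apply: le_average => A.
  by case: (leP _ c) => // /le_trans -/(_ _ c_le) ->.
have [s_mid|s_tiny] := leP (1 / 16) s.
  apply: (weaken (\sum_(i < 1) 94 / 25 * s + 2 ^- (5 + 0) + s ^+ 2)).
    by rewrite big_ord1 addn0; nra.
  apply: (chaining_star_discrepancy (sig2 := fun=> 4^-1) (c := fun=> 94 / 25)) => //.
  - move=> i; rewrite leqn0 => /eqP ->.
    by apply: (param_k0_cover u01 HE); rewrite addn0 (leq_trans _ H12).
  - by case=> // _; rewrite addn0; nra.
  - by case=> // _; rewrite addn0; lra.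
  - by case.
pose n := (H - 12)%N; have nH : (12 + n = H)%N by rewrite subnKC.
have hyp i : (0 < i <= n)%N -> [/\ (13 <= 12 + i)%N, s <= 8 * 2 ^- (12 + i)
    & 2 ^- (12 + i) <= 2 ^- 13 :> R].
  move=> /andP[i0 i_le]; split.
  - by rewrite -[X in (X < _)%N]addn0 ltn_add2l.
  - have H13 : (12 < H)%N by rewrite -subn_gt0 (leq_trans i0).
    have := Hs8 H13; have : 2 ^- H <= 2 ^- (12 + i) :> R.
      by rewrite lef_pV2 ?posrE ?exprn_gt0 // ler_eXn2l ?ltr1n // -nH leq_add2l.
    by lra.
  - by rewrite lef_pV2 ?posrE ?exprn_gt0 // ler_eXn2l ?ltr1n // -[13%N]/(12 + 1)%N leq_add2l.
apply: (weaken (\sum_(i < n.+1) chain_coef R i * s + 2 ^- (12 + n) + s ^+ 2)).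
  rewrite -mulr_suml nH; have := sum_chain_coef R n; set C := \sum_(i < _) _ => C_le.
  have : C * s <= (94 / 25 + 4 / 10) * s by rewrite ler_wpM2r // ltW.
  by nra.
apply: (chaining_star_discrepancy (sig2 := chain_var R)) => //.
- by move=> i i_le; apply: (param_k0_cover u01 HE); rewrite -nH leq_add2l.
- by case=> [|j] /=; rewrite ?mulr_ge0 ?exprn_ge0 ?divr_ge0.
- case=> [|j] j_le; first by rewrite addn0 /chain_var; nra.
  have [l13 s8 _] := hyp j.+1 j_le.
  have := entropy_pow2 R l13; rewrite /chain_var.
  have : 0 < 2 ^- (12 + j.+1) :> R by rewrite invr_gt0 exprn_gt0.
  set p := 2 ^- _ in s8 *; set x := (12 + _)%:R => p0 xp.
  have x0 : 0 <= x by [].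
  have : s ^+ 2 <= 64 * p ^+ 2 by nra.
  move=> sp; apply: (@le_trans _ _ ((1 + x * (7 / 10)) * (64 * p ^+ 2))).
    by rewrite ler_wpM2l //; lra.
  have : (1 + x * (7 / 10)) * p * p <= 1 / 64 * p by rewrite ler_wpM2r // ltW.
  by rewrite expr2; lra.
- by move=> i _; exact: chain_coef_var.
case=> // j j_le; have [l13 s8 p13] := hyp j.+1 j_le; rewrite /chain_var /=.
have : 0 < 2 ^- (12 + j.+1) :> R by rewrite invr_gt0 exprn_gt0.
set p := 2 ^- (12 + _) in s8 p13 * => p0.
have p13' : p <= 1 / 8192 by apply: le_trans p13 _; lra.
have : s ^+ 2 <= 64 * p ^+ 2 by nra.
nra.
Qed.

(** * From proportions of seeds to probabilities *)

Local Open Scope classical_set_scope.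

(** The event is a finite disjoint union of atoms, one for each value of the
    seed, and each atom has probability [#|E| ^ - k]. *)
Lemma probability_seed (R : realType) (disp : measure_display)
    (Omega : measurableType disp) (P : probability Omega R) (E : finType) (k : nat)
    (A : 'I_k -> Omega -> E) (Q : pred {ffun 'I_k -> E}) :
  independent_uniform P A ->
  P [set w | Q [ffun i => A i w]] = (average (fun a => (Q a)%:R : R))%:E.
Proof.
move=> [mA unifA indA].
pose atom (a : {ffun 'I_k -> E}) := [set w | forall i, A i w = a i].
have atomP a : P (atom a) = ((#|E|%:R ^- k)%:E)%E.
  have := indA finset.setT (fun i => [set a i]).
  have -> : [set w | forall i, i \in [set: 'I_k]%SET -> [set a i] (A i w)] = atom a.
    apply/seteqP; split=> w /= H i; last by move=> _; exact: H.
    by apply: H; rewrite finset.in_setT.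
  move=> ->; under eq_bigr do rewrite unifA.
  rewrite prodEFin; congr EFin; rewrite -exprVn.
  rewrite (eq_bigl xpredT) => [|i]; last by rewrite finset.in_setT.
  by rewrite prodr_const card_ord.
have matom a : measurable (atom a).
  have -> : atom a = \bigcap_(i in [set: 'I_k]) (A i @^-1` [set a i]).
    by apply/seteqP; split=> w /= H i; [move=> _; exact: H|exact: H].
  by apply: fin_bigcap_measurable => // i _; exact: mA.
have -> : [set w | Q [ffun i => A i w]] = \bigcup_(a in [set` enum Q]) atom a.
  apply/seteqP; split=> [w /= Qw|w /= [a]].
    exists [ffun i => A i w]; first by rewrite /= mem_enum.
    by move=> i; rewrite ffunE.
  rewrite /= mem_enum => Qa aw.
  suff -> : [ffun i => A i w] = a by [].
  by apply/ffunP => i; rewrite ffunE aw.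
rewrite measure_fin_bigcup //; last first.
  move=> a b _ _ [w [aw bw]].
  by apply/ffunP => i; rewrite -aw -bw.
rewrite -fsbig_seq ?enum_uniq // big_enum /=.
under eq_bigr do rewrite atomP.
rewrite sumEFin; congr EFin; rewrite /average card_ffun card_ord natrX mulr_suml.
rewrite [LHS]big_mkcond; apply: eq_bigr => a _.
by rewrite -topredE /=; case: (Q a); rewrite ?mul1r ?mul0r.
Qed.

Theorem theorem4p3 (R : realType) (d N : nat) (hd : (1 <= d)%N) (hN : (1 <= N)%N)
    (u : R) (hu : 0 < u < 1)
    (F : finFieldType) (hq : (N <= #|F|)%N)
    (xi : 'I_N -> F) (hxi : injective xi)
    (iot : F -> 'I_#|F|) (hiot : bijective iot)
    (disp : measure_display) (Omega : measurableType disp)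
    (P : probability Omega R)
    (A : 'I_(param_k0 d N u) -> Omega -> 'rV[F]_d)
    (hA : independent_uniform P A) :
  (u%:E <=
   P [set w | (star_discrepancy (polynomial_points R xi iot (fun i => A i w))
              <= 9 / 2 * Num.sqrt ((d%:R + ln ((1 - u)^-1) + 2) / N%:R))%R])%E.
Proof.
pose Q (B : {ffun 'I_(param_k0 d N u) -> 'rV[F]_d}) : bool :=
  star_discrepancy (polynomial_points R xi iot B)
    <= 9 / 2 * Num.sqrt (paramD d u / N%:R).
have AE w : (fun i => A i w) = [ffun i => A i w] by apply/funext => i; rewrite ffunE.
rewrite (_ : [set w | _] = [set w | Q [ffun i => A i w]]); last first.
  by apply/seteqP; split=> w /=; rewrite /Q -AE.
rewrite (probability_seed Q hA) lee_fin.
exact: star_discrepancy_average.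
Qed.
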